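(* Let $\{(N_k,B_k)\}_{k=1}^\infty$ be a sequence such that, for every $k\in\mathbb{N}$, $B_k=\{0,1,2,\dots,M_k-2,\;n_kM_k-1\}$, where $N_k\ge M_k\ge3$ and $n_k\ge0$ are integers. Suppose that every $M_k$ is odd and $\sum_{k=1}^\infty\frac1{M_k}<\infty$. Then the infinite convolution $\mu$ of $\{(N_k,B_k)\}_{k=1}^\infty$ is a spectral measure if and only if $M_k\mid N_k$ for all $k\ge2$.
   Context: $\mathbb{N}=\{1,2,3,\dots\}$. For a finite nonempty set $A\subset\mathbb{R}$, $\delta_A=\frac1{\#A}\sum_{a\in A}\delta_a$ with $\delta_a$ the Dirac measure at $a$. The infinite convolution $\mu=\delta_{N_1^{-1}B_1}*\delta_{(N_1N_2)^{-1}B_2}*\cdots$ is the weak limit, as $n\to\infty$, of $\delta_{N_1^{-1}B_1}*\cdots*\delta_{(N_1\cdots N_n)^{-1}B_n}$, a Borel probability measure on $\mathbb{R}$ (the limit exists under the hypotheses here). A Borel probability measure $\mu$ on $\mathbb{R}$ is a spectral measure if there is a countable $\Lambda\subseteq\mathbb{R}$ such that $\{e^{-2\pi i\lambda x}:\lambda\in\Lambda\}$ is an orthonormal basis of $L^2(\mu)$. *)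

(* Defs.v *)
From HB Require Import structures.
From mathcomp Require Import all_boot all_order all_algebra finmap.
From mathcomp Require Import complex.
From mathcomp Require Import all_classical all_reals all_analysis.
From mathcomp Require Import measurable_realfun.

Set Implicit Arguments.
Unset Strict Implicit.
Unset Printing Implicit Defensive.
Import Order.TTheory GRing.Theory Num.Theory.
Import numFieldNormedType.Exports ComplexField.

Local Open Scope classical_set_scope.
Local Open Scope ring_scope.

Section uniform_measure.
Context {R : realType}.
Local Open Scope ereal_scope.

(* A probability measure when A is nonempty, the zero measure otherwise. *)
Definition uniform_fset (A : {fset R}) : set R -> \bar R :=
  fun U => ((#|` A|%:R : R)^-1)%:E * \sum_(a <- A) \d_a U.

Variable A : {fset R}.

Let card_inv : {nonneg R} := NngNum (eqbRL (invr_ge0 _) (ler0n R #|` A|)).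

Let diracs (k : nat) : {measure set R -> \bar R} :=
  \d_(nth 0%R A k).

Let uniform_fsetE : uniform_fset A = mscale card_inv (msum diracs #|` A|).
Proof.
apply/funext => U; rewrite /uniform_fset /mscale /= /msum; congr (_ * _).
by rewrite (big_nth 0%R) big_mkord.
Qed.

Let uniform_fset0 : uniform_fset A set0 = 0.
Proof. by rewrite uniform_fsetE measure0. Qed.

Let uniform_fset_ge0 U : 0 <= uniform_fset A U.
Proof. by rewrite uniform_fsetE measure_ge0. Qed.

Let uniform_fset_sigma_additive : semi_sigma_additive (uniform_fset A).
Proof. by rewrite uniform_fsetE; exact: measure_semi_sigma_additive. Qed.

HB.instance Definition _ := isMeasure.Build _ _ _ (uniform_fset A)
  uniform_fset0 uniform_fset_ge0 uniform_fset_sigma_additive.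

Let uniform_fset_fin : fin_num_fun (uniform_fset A).
Proof.
move=> U _; rewrite /uniform_fset fin_numM//.
by apply/sum_fin_numP => a _ _; rewrite diracE.
Qed.

HB.instance Definition _ := Measure_isFinite.Build _ _ _ (uniform_fset A)
  uniform_fset_fin.

End uniform_measure.

Section convolution.
Context {R : realType}.
Local Open Scope ereal_scope.
Variables mu nu : {finite_measure set R -> \bar R}.

Let add (p : R * R) : R := (p.1 + p.2)%R.

Definition convolution : set R -> \bar R :=
  pushforward (mu \x nu) add.

Let measurable_add : measurable_fun setT add.
Proof. exact: measurable_funD. Qed.

Let convolution0 : convolution set0 = 0.
Proof. by rewrite /convolution /pushforward preimage_set0 measure0. Qed.

Let convolution_ge0 U : 0 <= convolution U.
Proof. by rewrite /convolution /pushforward measure_ge0. Qed.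

Let convolution_sigma_additive : semi_sigma_additive convolution.
Proof.
move=> F mF tF mUF; rewrite /convolution /pushforward preimage_bigcup.
apply: measure_semi_sigma_additive.
- by move=> n; rewrite -[X in measurable X]setTI; exact: measurable_add.
- apply/trivIsetP => /= i j _ _ ij; rewrite -preimage_setI.
  by move/trivIsetP : tF => /(_ _ _ _ _ ij) ->//; rewrite preimage_set0.
- by rewrite -preimage_bigcup -[X in measurable X]setTI; exact: measurable_add.
Qed.

HB.instance Definition _ := isMeasure.Build _ _ _ convolution
  convolution0 convolution_ge0 convolution_sigma_additive.

Let convolution_fin : fin_num_fun convolution.
Proof.
have ltoo : convolution setT < +oo.
  rewrite /convolution /pushforward preimage_setT -setXTT product_measure1E//.
  by rewrite ltey_eq fin_numM// fin_num_measure.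
exact: lty_fin_num_fun.
Qed.

HB.instance Definition _ := Measure_isFinite.Build _ _ _ convolution
  convolution_fin.

End convolution.

Section infinite_convolution.
Context {R : realType}.

(* Sequences (N_k, B_k) are indexed by k >= 1; values at 0 are never used. *)
Definition scaled_digits (N : nat -> nat) (B : nat -> {fset int}) (k : nat) :
    {fset R} :=
  [fset ((\prod_(1 <= j < k.+1) N j)%N%:R)^-1 * b%:~R | b in B k]%fset.

(* The empty convolution is the unit, the Dirac measure at 0. *)
Fixpoint finite_convolution (N : nat -> nat) (B : nat -> {fset int}) (n : nat) :
    {finite_measure set R -> \bar R} :=
  if n is m.+1 then
    convolution (finite_convolution N B m) (uniform_fset (scaled_digits N B n))
  else dirac (0 : R).

Definition weak_limit
    (m : nat -> {finite_measure set R -> \bar R})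
    (mu : probability R R) : Prop :=
  forall f : R -> R, continuous f -> (exists C : R, forall x, `|f x| <= C) ->
    (fun n => (\int[m n]_x (f x)%:E)%E) @ \oo --> (\int[mu]_x (f x)%:E)%E.

Definition infinite_convolution (N : nat -> nat) (B : nat -> {fset int})
    (mu : probability R R) : Prop :=
  weak_limit (finite_convolution N B) mu.

End infinite_convolution.

Section spectral_measure.
Context {R : realType}.
Variable mu : probability R R.
Implicit Types f g : R -> R[i].

Definition L2norm f : \bar R := ('N[mu]_2%:E[EFin \o (fun x => Normc.normc (f x))])%E.

Definition in_L2 f : Prop :=
  [/\ measurable_fun setT (fun x => complex.Re (f x)),
      measurable_fun setT (fun x => complex.Im (f x))
    & (L2norm f < +oo)%E].

Definition L2inner f g : R[i] :=
  let h x := f x * (g x)^*%C in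
  Complex (\int[mu]_x complex.Re (h x)) (\int[mu]_x complex.Im (h x)).

(* Functions are not quotiented by a.e. equality: for an orthonormal family,
   density of the span in the L2 seminorm is density in the quotient. *)
Definition orthonormal_basis {I : choiceType} (D : set I)
    (e : I -> R -> R[i]) : Prop :=
  [/\ forall i, D i -> in_L2 (e i),
      forall i j, D i -> D j -> L2inner (e i) (e j) = (i == j)%:R
    & forall f, in_L2 f -> forall eps : R, 0 < eps ->
        exists (s : {fset I}) (c : I -> R[i]), [set` s] `<=` D /\
          (L2norm (fun x => f x - \sum_(i <- s) c i * e i x)%R < eps%:E)%E].

(* e^(-2 pi i lambda x) *)
Definition character (lambda : R) (x : R) : R[i] :=
  Complex (cos (2 * pi * lambda * x)) (- sin (2 * pi * lambda * x)).

Definition spectral_measure : Prop :=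
  exists L : set R, countable L /\ orthonormal_basis L character.

End spectral_measure.

(* {0, ..., M - 2, n M - 1}; the last element is the integer -1 when n = 0. *)
Definition digits (M n : nat) : {fset int} :=
  ([fset i%:Z | i in iota 0 M.-1] `|` [fset (n * M)%N%:Z - 1])%fset.

(* Main.v *)
Require Import Defs.
From mathcomp Require Import all_boot all_order all_algebra finmap.
From mathcomp Require Import complex.
From mathcomp Require Import all_classical all_reals all_analysis.
From mathcomp Require Import measurable_realfun ring lra zify.
Set Implicit Arguments.
Unset Strict Implicit.
Unset Printing Implicit Defensive.
Import Order.TTheory GRing.Theory Num.Theory.
Import numFieldNormedType.Exports ComplexField.
Local Open Scope classical_set_scope.
Local Open Scope ring_scope.

(** Write [P_k = N_1 ... N_k].  The measure is the law of the random series
    [\sum_k b_k / P_k] with independent [b_k] uniform on [B_k], so its Fourier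
    transform is the product of the masks [m_k (x / P_k)].  Because [M_k] is odd,
    [m_k] vanishes exactly on the multiples of [1 / M_k] that are not integers
    ([mask_eq0P]); because the series of [1 / M_k] converges, the tails of the product
    stay away from zero at moderate arguments ([transform_lower]).  Hence the zeros of
    the transform are the union of the sets [Z_k], where [Z_k] is the lattice of step
    [P_k / M_k] deprived of the multiples of [P_k] ([fourier_eq0]).

    Sufficiency.  The frequencies are the finite sums of the [l_k P_k / M_k] with
    integers [l_k] of absolute value at most [(M_k - 1) / 2].  Divisibility puts every
    difference of two of them in some [Z_k], whence orthogonality; and since [B_k] is a
    complete residue system modulo [M_k], Parseval's identity holds exactly for the
    finite convolutions ([frequencies_Parseval]).  As the [l_k] are centred, a
    frequency of level [m] has absolute value at most [P_m / 2], where the tail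
    transforms are bounded below, so that no mass escapes in the limit and every
    exponential lies in the closed span of those with the chosen frequencies
    ([expi_in_span]).  The exponentials span all of L^2: polynomials in sines converge
    to indicators of rays, which generate the Borel sets ([in_span_L2]).

    Necessity.  Let [M_k] not divide [N_k] for some [k >= 2], and suppose that a spectrum
    exists.  Colour the line so that two points of one colour never differ by an
    element of [Z_1], ..., [Z_K].  Each level [j] taken alone requires [M_j] colours, but
    the two levels [k - 1] and [k] together can be treated with [M_(k-1) M_k - 1]
    ([colourable_pair]).  The frequencies of one colour are orthonormal for the tail
    [theta] of the convolution beyond level [K].  So, by Bessel's inequality, the
    coefficients of a function [phi] against [theta] have square sum at most
    [(1 - 1 / (M_(k-1) M_k)) M_1 ... M_K] times the squared norm of [phi].

    On the other hand the measure is the average of the translates of [theta] by the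
    [M_1 ... M_K] points of the convolution of the first [K] levels, and the last digit
    of each [B_j], the only irregular one, has mass [1 / M_j]: for large [K] almost all
    of [theta] sits in a cell of length [1 / P_K].  Let [phi] be a bump on this cell.
    Bessel's inequality at a point of multiplicity [C] bounds the square sum by
    [M_1 ... M_K / C], while expanding the translate of [phi] to a point of
    multiplicity one in the orthonormal basis bounds it below.  The two bounds force
    [C = 1], and then the lower bound is nearly [M_1 ... M_K], against the previous
    paragraph ([mass_contradiction]).

    The tail measures are never constructed: all estimates are made for finite
    convolutions, against which integrals are averages over finite lists, and weak
    convergence is applied to a few bounded continuous functions only. *)

(** * The exponential and the squared modulus *)

Section complex_exponential.
Context {R : realType}.
Implicit Types (z w : R[i]) (s t : R).

(** The norm of [R[i]] takes its values in [R[i]]; this is its square, in [R]. *)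
Definition nsq z : R := complex.Re z ^+ 2 + complex.Im z ^+ 2.

(** The character of the circle with the sign of [character]: exp (- 2 i pi t). *)
Definition expi t : R[i] := Complex (cos (2 * pi * t)) (- sin (2 * pi * t)).

Lemma nsq_ge0 z : 0 <= nsq z. Proof. by rewrite addr_ge0// sqr_ge0. Qed.

Lemma nsq0 : nsq 0 = 0. Proof. by rewrite /nsq /= expr0n addr0. Qed.
Lemma nsq1 : nsq 1 = 1. Proof. by rewrite /nsq /= expr0n expr1n addr0. Qed.

Lemma nsqE z : (nsq z)%:C%C = z * (z^*)%C.
Proof. by case: z => a b; rewrite /nsq; simpc; congr Complex; ring. Qed.

Lemma nsqM z w : nsq (z * w) = nsq z * nsq w.
Proof. by case: z w => a b [c d]; rewrite /nsq; simpc => /=; ring. Qed.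

Lemma nsq_conj z : nsq (z^*)%C = nsq z.
Proof. by case: z => a b; rewrite /nsq /= sqrrN. Qed.

Lemma nsqN z : nsq (- z) = nsq z.
Proof. by case: z => a b; rewrite /nsq /= !sqrrN. Qed.

Lemma nsq_real s : nsq s%:C%C = s ^+ 2.
Proof. by rewrite /nsq /= expr0n addr0. Qed.

Lemma nsq_eq0 z : (nsq z == 0) = (z == 0).
Proof.
case: z => a b; rewrite /nsq /= paddr_eq0 ?sqr_ge0// !sqrf_eq0.
by rewrite eq_complex.
Qed.

Lemma nsq_normc z : nsq z = Normc.normc z ^+ 2.
Proof. by case: z => a b; rewrite /nsq /= sqr_sqrtr// addr_ge0// sqr_ge0. Qed.

Lemma nsqD_le z w : nsq (z + w) <= 2 * nsq z + 2 * nsq w.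
Proof.
case: z w => a b [c d]; rewrite /nsq /=.
have := sqr_ge0 (a - c); have := sqr_ge0 (b - d); nra.
Qed.

(** Peter--Paul inequality, the form of the triangle inequality that avoids
    square roots. *)
Lemma nsqD_weighted z w t : 0 < t ->
  nsq (z + w) <= (1 + t) * nsq z + (1 + t^-1) * nsq w.
Proof.
move=> t0; case: z w => a b [c d]; rewrite /nsq /= -subr_ge0.
have tt : t * t^-1 = 1 by rewrite divff ?gt_eqF.
have -> : (1 + t) * (a ^+ 2 + b ^+ 2) + (1 + t^-1) * (c ^+ 2 + d ^+ 2) -
  ((a + c) ^+ 2 + (b + d) ^+ 2) = t^-1 * ((t * a - c) ^+ 2 + (t * b - d) ^+ 2).
  by field; rewrite gt_eqF.
by rewrite mulr_ge0 ?addr_ge0 ?sqr_ge0// invr_ge0 ltW.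
Qed.

Lemma expiD s t : expi (s + t) = expi s * expi t.
Proof.
by rewrite /expi mulrDr cosD sinD; simpc; congr Complex; ring.
Qed.

Lemma expi0 : expi 0 = 1.
Proof. by rewrite /expi mulr0 cos0 sin0 oppr0. Qed.

Lemma expiN t : expi (- t) = (expi t)^*%C.
Proof. by rewrite /expi mulrN cosN sinN. Qed.

Lemma nsq_expi t : nsq (expi t) = 1.
Proof. by rewrite /nsq /= sqrrN cos2Dsin2. Qed.

Lemma expiJ t : expi t * (expi t)^*%C = 1.
Proof. by rewrite -nsqE nsq_expi. Qed.

Lemma expi_neq0 t : expi t != 0.
Proof. by rewrite -nsq_eq0 nsq_expi oner_eq0. Qed.

Lemma expiMn t k : expi (k%:R * t) = expi t ^+ k.
Proof.
by elim: k => [|k IH]; rewrite ?mul0r ?expi0// -natr1 mulrDl mul1r expiD IH exprSr.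
Qed.

Lemma expi1 : expi 1 = 1.
Proof. by rewrite /expi mulr1 mulrC mulr_natr cos2pi sin2pi oppr0. Qed.

Lemma expi_int t : t \is a Num.int -> expi t = 1.
Proof.
have en k : expi k%:R = 1 by rewrite -[k%:R]mulr1 expiMn expi1 expr1n.
move=> /intrP[m ->]; case: m => m; first exact: en.
by rewrite NegzE mulrNz expiN en conjc1.
Qed.

Lemma expi_eq1 t : expi t = 1 -> t \is a Num.int.
Proof.
move=> et1; set r := t - (Num.floor t)%:~R.
have er1 : expi r = 1.
  rewrite /r expiD et1 mul1r expi_int//.
  by rewrite rpredN intr_int.
have r0 : 0 <= r by rewrite subr_ge0 floor_le.
have r1 : r < 1 by rewrite ltrBlDl -intrD1 floorD1_gt.
have s0 : sin (pi * r) = 0.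
  have : cos (2 * pi * r) = 1 by case: er1.
  have -> : 2 * pi * r = (pi * r) *+ 2 by rewrite -mulr_natr; ring.
  rewrite cos_mulr2n => c1; apply/eqP; rewrite -sqrf_eq0 sin2cos2; apply/eqP.
  by move: c1; rewrite -mulr_natr; lra.
have : r = 0.
  apply/eqP; rewrite eq_le r0 andbT leNgt; apply/negP => rgt0.
  have : 0 < sin (pi * r).
    by apply: sin_gt0_pi; rewrite mulr_gt0 ?pi_gt0//= gtr_pMr ?pi_gt0.
  by rewrite s0 ltxx.
by move/eqP; rewrite subr_eq0 => /eqP ->; exact: intr_int.
Qed.

End complex_exponential.

(** * Averages over finite lists of points *)

Section mean.
Context {R : realType}.
Implicit Types s t : seq R.

Definition mean {F : fieldType} s (f : R -> F) : F :=
  (\sum_(x <- s) f x) / (size s)%:R.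

Definition inner s (f g : R -> R[i]) : R[i] :=
  mean s (fun x => f x * ((g x)^*)%C).

Section field_valued.
Context {F : fieldType}.
Implicit Types f g : R -> F.

Lemma eq_mean s f g : {in s, f =1 g} -> mean s f = mean s g.
Proof. by move=> fg; rewrite /mean (eq_big_seq _ fg). Qed.

Lemma meanD s f g : mean s (fun x => f x + g x) = mean s f + mean s g.
Proof. by rewrite /mean big_split mulrDl. Qed.

Lemma meanZ s c f : mean s (fun x => c * f x) = c * mean s f.
Proof. by rewrite /mean -mulr_sumr mulrA. Qed.

Lemma meanN s f : mean s (fun x => - f x) = - mean s f.
Proof. by rewrite /mean sumrN mulNr. Qed.

Lemma mean_sum (I : Type) (r : seq I) s (f : I -> R -> F) :
  mean s (fun x => \sum_(i <- r) f i x) = \sum_(i <- r) mean s (f i).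
Proof. by rewrite /mean exchange_big mulr_suml. Qed.

Lemma mean_sumset s t f :
  mean [seq x + y | x <- s, y <- t] f = mean s (fun x => mean t (fun y => f (x + y))).
Proof.
rewrite /mean big_allpairs_dep size_allpairs natrM invfM mulrA.
by rewrite mulrAC mulr_suml; congr (_ / _); rewrite mulr_suml.
Qed.

Lemma perm_mean s t f : perm_eq s t -> mean s f = mean t f.
Proof. by move=> st; rewrite /mean (perm_big _ st) (perm_size st). Qed.

End field_valued.

Lemma mean_ge0 s (f : R -> R) : (forall x, 0 <= f x) -> 0 <= mean s f.
Proof. by move=> f0; rewrite mulr_ge0 ?invr_ge0// sumr_ge0. Qed.

Lemma le_mean s (f g : R -> R) : {in s, forall x, f x <= g x} -> mean s f <= mean s g.
Proof.
move=> fg; rewrite ler_wpM2r ?invr_ge0//.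
by rewrite big_seq [leRHS]big_seq ler_sum.
Qed.

Lemma mean_cst {F : numFieldType} s (c : F) : s != [::] -> mean s (fun=> c) = c.
Proof.
rewrite -size_eq0 => s0; rewrite /mean big_const_seq count_predT iter_addr addr0.
by rewrite -[c *+ _]mulr_natr mulfK// pnatr_eq0.
Qed.

Lemma mean_C s (f : R -> R) : mean s (fun x => (f x)%:C%C) = (mean s f)%:C%C.
Proof. by rewrite /mean rmorphM/= fmorphV/= rmorph_sum/= rmorph_nat. Qed.

Lemma Re_mean s (f : R -> R[i]) :
  complex.Re (mean s f) = mean s (fun x => complex.Re (f x)).
Proof.
rewrite /mean -[(size s)%:R]/((size s)%:R : R[i]).
have -> : ((size s)%:R : R[i])^-1 = ((size s)%:R^-1)%:C%C.
  by rewrite fmorphV/= rmorph_nat.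
have -> (z : R[i]) (c : R) : complex.Re (z * c%:C%C) = complex.Re z * c.
  by case: z => a b; simpc.
by congr (_ * _); elim: s => [|x s IH]; rewrite ?big_nil// !big_cons/= -IH raddfD.
Qed.

Lemma Im_mean s (f : R -> R[i]) :
  complex.Im (mean s f) = mean s (fun x => complex.Im (f x)).
Proof.
rewrite /mean -[(size s)%:R]/((size s)%:R : R[i]).
have -> : ((size s)%:R : R[i])^-1 = ((size s)%:R^-1)%:C%C.
  by rewrite fmorphV/= rmorph_nat.
have -> (z : R[i]) (c : R) : complex.Im (z * c%:C%C) = complex.Im z * c.
  by case: z => a b; simpc.
by congr (_ * _); elim: s => [|x s IH]; rewrite ?big_nil// !big_cons/= -IH raddfD.
Qed.

Lemma mean_conj s (f : R -> R[i]) :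
  ((mean s f)^*)%C = mean s (fun x => (f x)^*%C).
Proof. by rewrite /mean rmorphM/= fmorphV/= rmorph_sum/= conjc_nat. Qed.

(** Lagrange's identity: the squared minors [a i * b j - a j * b i] add up to
    twice the difference of the two sides. *)
Lemma Cauchy_Schwarz_sum (I : Type) (r : seq I) (a b : I -> R[i]) :
  nsq (\sum_(i <- r) a i * (b i)^*%C) <=
  (\sum_(i <- r) nsq (a i)) * (\sum_(i <- r) nsq (b i)).
Proof.
set S := \sum_(i <- r) a i * _; set A := \sum_(i <- r) _; set B := \sum_(i <- r) _.
have : 0 <= \sum_(i <- r) \sum_(j <- r) nsq (a i * b j - a j * b i).
  by apply: sumr_ge0 => i _; apply: sumr_ge0 => j _; exact: nsq_ge0.
suff -> : \sum_(i <- r) \sum_(j <- r) nsq (a i * b j - a j * b i) =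
          2 * (A * B - nsq S) by lra.
apply: complexI; rewrite rmorph_sum/=.
under eq_bigr do rewrite rmorph_sum/=.
have -> : (2 * (A * B - nsq S))%:C%C = A%:C%C * B%:C%C + B%:C%C * A%:C%C - (S * S^*%C + S^*%C * S).
  by rewrite -!rmorphM/= (mulrC S^*%C) -nsqE -!rmorphD -rmorphB /=; congr (_%:C%C); ring.
have AE : A%:C%C = \sum_(i <- r) a i * (a i)^*%C.
  by rewrite rmorph_sum/=; apply: eq_bigr => i _; exact: nsqE.
have BE : B%:C%C = \sum_(i <- r) b i * (b i)^*%C.
  by rewrite rmorph_sum/=; apply: eq_bigr => i _; exact: nsqE.
have SE : S^*%C = \sum_(i <- r) (a i)^*%C * b i.
  by rewrite rmorph_sum/=; apply: eq_bigr => i _; rewrite rmorphM/= conjcK.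
rewrite SE AE BE /S !mulr_suml -!big_split/= -sumrB; apply: eq_bigr => i _.
rewrite !mulr_sumr -!big_split/= -sumrB; apply: eq_bigr => j _.
by rewrite -/(nsq _) nsqE rmorphB/= !rmorphM/=; ring.
Qed.

Lemma Cauchy_Schwarz_mean s (f g : R -> R[i]) :
  nsq (inner s f g) <= mean s (fun x => nsq (f x)) * mean s (fun x => nsq (g x)).
Proof.
rewrite /inner /mean.
have -> : ((size s)%:R : R[i])^-1 = ((size s)%:R^-1)%:C%C.
  by rewrite fmorphV/= rmorph_nat.
rewrite nsqM nsq_real mulrACA -expr2 ler_wpM2r ?sqr_ge0//.
exact: Cauchy_Schwarz_sum.
Qed.

Lemma inner_diag s (f : R -> R[i]) : inner s f f = (mean s (fun x => nsq (f x)))%:C%C.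
Proof. by rewrite -mean_C; apply: eq_mean => x _; rewrite nsqE. Qed.

Section orthonormal_family.
Context (I : eqType) (r : seq I) (e : I -> R -> R[i]) (s : seq R).
Hypothesis r_uniq : uniq r.
Hypothesis e_orth : {in r &, forall i j, inner s (e i) (e j) = (i == j)%:R}.

(** Pythagoras: the distance to a combination of orthonormal functions splits into
    the distance to the orthogonal projection and the error on the coefficients. *)
Lemma mean_nsqB (f : R -> R[i]) (c : I -> R[i]) :
  mean s (fun x => nsq (f x - \sum_(i <- r) c i * e i x)) =
  mean s (fun x => nsq (f x)) - \sum_(i <- r) nsq (inner s f (e i)) +
  \sum_(i <- r) nsq (c i - inner s f (e i)).
Proof.
apply: complexI; rewrite -inner_diag rmorphD rmorphB !rmorph_sum/=.
set d := fun i => inner s f (e i).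
have ffE : (mean s (fun x => nsq (f x)))%:C%C = mean s (fun x => f x * (f x)^*%C).
  by rewrite -inner_diag.
have -> : inner s (fun x => f x - \sum_(i <- r) c i * e i x)
                  (fun x => f x - \sum_(i <- r) c i * e i x) =
   inner s f f - \sum_(i <- r) (c i)^*%C * d i - \sum_(i <- r) c i * (d i)^*%C
   + \sum_(i <- r) c i * (c i)^*%C.
  have -> : \sum_(i <- r) c i * (c i)^*%C =
      \sum_(i <- r) c i * \sum_(j <- r) (c j)^*%C * inner s (e i) (e j).
    apply: eq_big_seq => i ir; congr (_ * _).
    rewrite (bigD1_seq i)//= big1_seq ?addr0 ?e_orth ?eqxx ?mulr1// => j /andP[ji jr].
    by rewrite e_orth// eq_sym (negbTE ji) mulr0.
  have -> : \sum_(i <- r) (c i)^*%C * d i =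
     mean s (fun x => \sum_(i <- r) (c i)^*%C * (f x * (e i x)^*%C)).
    by rewrite mean_sum; apply: eq_bigr => i _; rewrite meanZ.
  have -> : \sum_(i <- r) c i * (d i)^*%C =
     mean s (fun x => \sum_(i <- r) c i * ((f x)^*%C * e i x)).
    rewrite mean_sum; apply: eq_bigr => i _; rewrite meanZ /d mean_conj; congr (_ * _).
    by apply: eq_mean => x _; rewrite rmorphM/= conjcK.
  have -> : \sum_(i <- r) c i * (\sum_(j <- r) (c j)^*%C * inner s (e i) (e j)) =
     mean s (fun x => \sum_(i <- r) c i * (\sum_(j <- r) (c j)^*%C * (e i x * (e j x)^*%C))).
    rewrite mean_sum; apply: eq_bigr => i _; rewrite meanZ mean_sum; congr (_ * _).
    by apply: eq_bigr => j _; rewrite meanZ.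
  rewrite -!meanN -!meanD; apply: eq_mean => x _.
  set p := \sum_(i <- r) c i * e i x.
  have pJ : (p^*)%C = \sum_(i <- r) (c i)^*%C * (e i x)^*%C.
    by rewrite rmorph_sum/=; apply: eq_bigr => i _; rewrite rmorphM.
  have -> : \sum_(i <- r) (c i)^*%C * (f x * (e i x)^*%C) = f x * (p^*)%C.
    by rewrite pJ mulr_sumr; apply: eq_bigr => i _; ring.
  have -> : \sum_(i <- r) c i * ((f x)^*%C * e i x) = p * (f x)^*%C.
    by rewrite mulr_suml; apply: eq_bigr => i _; ring.
  have -> : \sum_(i <- r) c i * (\sum_(j <- r) (c j)^*%C * (e i x * (e j x)^*%C)) =
      p * (p^*)%C.
    rewrite pJ mulr_suml; apply: eq_bigr => i _; rewrite !mulr_sumr.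
    by apply: eq_bigr => j _; ring.
  by rewrite rmorphB/=; ring.
rewrite ffE -/(inner s f f) -!sumrN -!addrA; congr (_ + _).
rewrite -!big_split/=; apply: eq_bigr => i _.
by rewrite -/(nsq _) -/(nsq _) !nsqE rmorphB/= -/(d i); ring.
Qed.

Lemma Bessel (f : R -> R[i]) : \sum_(i <- r) nsq (inner s f (e i)) <= mean s (fun x => nsq (f x)).
Proof.
have := mean_nsqB f (fun i => inner s f (e i)).
rewrite [X in _ = _ + X]big1 ?addr0 => [E|i _]; last by rewrite subrr nsq0.
by rewrite -subr_ge0 -E; apply: mean_ge0 => x; exact: nsq_ge0.
Qed.

Lemma mean_nsq_lincomb (c : I -> R[i]) :
  mean s (fun x => nsq (\sum_(i <- r) c i * e i x)) = \sum_(i <- r) nsq (c i).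
Proof.
have i0 i : inner s (fun=> 0) (e i) = 0.
  by rewrite /inner /mean big1 ?mul0r// => x _; rewrite mul0r.
transitivity (mean s (fun x => nsq (0 - \sum_(i <- r) c i * e i x))).
  by apply: eq_mean => x _; rewrite sub0r nsqN.
rewrite mean_nsqB.
under eq_bigr do rewrite i0 nsq0.
under [X in _ + X]eq_bigr do rewrite i0 subr0.
by rewrite big1// /mean big1 ?mul0r ?subr0 ?add0r// => x _; rewrite nsq0.
Qed.

End orthonormal_family.
End mean.

(** * Mask polynomials: zeros and Parseval identity *)

Section mask.
Context {R : realType}.
Implicit Types (x t : R) (M n : nat).

(** The irregular last digit is congruent to [M - 1]: the digits are a complete
    residue system modulo [M]. *)
Definition digit_seq M n : seq int :=
  rcons [seq i%:Z | i <- iota 0 M.-1] ((n * M)%N%:Z - 1).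

Definition mask M n x : R[i] :=
  (\sum_(b <- digit_seq M n) expi (b%:~R * x)) / M%:R.

Lemma size_digit_seq M n : (0 < M)%N -> size (digit_seq M n) = M.
Proof. by move=> M0; rewrite size_rcons size_map size_iota prednK. Qed.

Lemma digit_seq_uniq M n : (0 < M)%N -> uniq (digit_seq M n).
Proof.
move=> M0; rewrite rcons_uniq map_inj_uniq ?iota_uniq ?andbT; last by move=> i j [].
apply/mapP => - [k +]; rewrite mem_iota add0n => kM.
by case: n => [|n]; rewrite ?mulSn; lia.
Qed.

Lemma perm_digits M n : (0 < M)%N -> perm_eq (digits M n) (digit_seq M n).
Proof.
move=> M0; apply: uniq_perm => //; first exact: digit_seq_uniq.
move=> b; rewrite mem_rcons in_cons in_fsetU in_fset1 orbC; congr (_ || _).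
by apply/imfsetP/mapP => - [k kin ->]; exists k.
Qed.

Lemma big_digit_seq M n (V : nmodType) (F : int -> V) :
  \sum_(b <- digit_seq M n) F b =
  \sum_(i < M.-1) F i%:Z + F ((n * M)%N%:Z - 1).
Proof.
rewrite /digit_seq -cats1 big_cat big_seq1/= big_map.
by rewrite -[X in iota 0 X](subn0 M.-1) -/(index_iota 0 M.-1) big_mkord.
Qed.

Lemma mask_periodic M n x k : k \is a Num.int -> mask M n (x + k) = mask M n x.
Proof.
move=> kint; congr (_ / _); apply: eq_bigr => b _.
by rewrite mulrDr expiD [expi (_ * k)]expi_int ?mulr1// rpredM ?intr_int.
Qed.

Lemma geometric_root_of_unity M (w : R[i]) :
  w != 1 -> w ^+ M = 1 -> \sum_(i < M) w ^+ i = 0.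
Proof.
move=> w1 wM; have := subrX1 w M; rewrite wM subrr => /esym/eqP.
by rewrite mulf_eq0 subr_eq0 (negbTE w1) => /eqP.
Qed.

Lemma expi_last_digit M n x : (0 < M)%N -> M%:R * x \is a Num.int ->
  expi (((n * M)%N%:Z - 1)%:~R * x) = expi (M.-1%:R * x) .
Proof.
case: M => // M _ Mx.
have -> : ((n * M.+1)%N%:Z - 1)%:~R * x =
   M%:R * x + (n%:R - 1) * (M.+1%:R * x).
  by rewrite intrD mulrNz mulr1z -pmulrn natrM -!natr1; ring.
by rewrite expiD [expi ((n%:R - 1) * _)]expi_int ?mulr1// rpredM// rpredB ?rpred1// natr_int.
Qed.

(** Put [w = expi x].  If the mask vanishes, the geometric sum of the regular
    digits is opposite to a number of modulus one, so [w ^+ M.-1] and [w] are equally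
    far from 1, hence equal or conjugate.  In the second case [w ^+ M = 1].  In the
    first case [w ^+ M.-2 = 1] while the term of the last digit is [-1], a power
    of [w]: impossible, as [M - 2] is odd. *)
Lemma mask_eq0P M n x : odd M -> (2 < M)%N ->
  mask M n x = 0 <-> M%:R * x \is a Num.int /\ x \isn't a Num.int.
Proof.
move=> oddM M2; have M0 : M%:R != 0 :> R[i] by rewrite pnatr_eq0; lia.
have Mpred : M = M.-1.+1 by lia.
set v := expi (((n * M)%N%:Z - 1)%:~R * x).
set w := expi x.
have maskE : mask M n x = (\sum_(i < M.-1) w ^+ i + v) / M%:R.
  rewrite /mask big_digit_seq; congr ((_ + _) / _).
  by apply: eq_bigr => i _; rewrite -expiMn -pmulrn.
have wint k : w ^+ k = 1 -> k%:R * x \is a Num.int.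
  by rewrite -expiMn => /expi_eq1.
split; last first.
  move=> [Mx xint]; rewrite maskE /v expi_last_digit ?(ltn_trans _ M2)// expiMn.
  rewrite -[_ + _]/(_ + w ^+ M.-1).
  have <- : \sum_(i < M.-1.+1) w ^+ i = \sum_(i < M.-1) w ^+ i + w ^+ M.-1 by rewrite big_ord_recr.
  rewrite -Mpred geometric_root_of_unity ?mul0r//.
    by apply: contra xint => /eqP/expi_eq1.
  by rewrite -expiMn expi_int.
rewrite maskE => /eqP; rewrite mulf_eq0 invr_eq0 (negbTE M0) orbF => /eqP Sv0.
have w1 : w != 1.
  apply/eqP => w1; have xint := expi_eq1 w1.
  move: Sv0; rewrite /v expi_int ?rpredM ?intr_int//.
  under eq_bigr do rewrite w1 expr1n.
  rewrite sumr_const card_ord natr1 -Mpred => /eqP; exact/negP.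
have wv : w ^+ M.-1 - 1 = - ((w - 1) * v).
  by rewrite subrX1 -mulrN; congr (_ * _); apply/eqP; rewrite -addr_eq0 Sv0.
have unit_sub1 (u : R[i]) : nsq u = 1 -> nsq (u - 1) = 2 - 2 * complex.Re u.
  by case: u => a b; rewrite /nsq /= => ab; nra.
have nw : nsq w = 1 by exact: nsq_expi.
have na : nsq (w ^+ M.-1) = 1 by rewrite -expiMn nsq_expi.
have eqRe : complex.Re (w ^+ M.-1) = complex.Re w.
  have : nsq (w ^+ M.-1 - 1) = nsq (w - 1) by rewrite wv nsqN nsqM nsq_expi mulr1.
  by rewrite !unit_sub1// => h; lra.
have : w ^+ M.-1 = w \/ w ^+ M.-1 = (w^*)%C.
  move: eqRe na nw; case: (w ^+ M.-1) => a b; case: (w) => c d; rewrite /nsq /= => -> h1 h2.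
  have /eqP : b ^+ 2 = d ^+ 2 by lra.
  by rewrite eqf_sqr => /orP[/eqP->|/eqP->]; [left|right].
case=> [aw|aw]; last first.
  split; last by apply/negP => /expi_int; exact/eqP.
  by apply: wint; rewrite Mpred exprSr aw mulrC expiJ.
(* the first case, excluded by parity *)
exfalso; have wM2 : w ^+ M.-2 = 1.
  apply: (mulIf (expi_neq0 x)); rewrite -exprSr mul1r -/w -[RHS]aw; congr (_ ^+ _); lia.
have vN1 : v = -1.
  apply: (mulfI (x := w - 1)); first by rewrite subr_eq0.
  by rewrite mulrN1 -{2}aw wv opprK.
have : v ^+ M.-2 = 1.
  rewrite -expiMn mulrCA expi_int// rpredM ?intr_int//; exact: wint.
rewrite vN1 -signr_odd (_ : odd M.-2) ?expr1; last by lia.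
by move/eqP; rewrite -subr_eq0 -opprD oppr_eq0 -[1 + 1]/(2%:R) pnatr_eq0.
Qed.

(** A complete residue system modulo M makes the characters of the digit set
    orthonormal on the M points i/M. *)
Lemma mask_Parseval M n x : (0 < M)%N ->
  \sum_(i < M) nsq (mask M n (x + i%:R / M%:R)) = 1.
Proof.
move=> M0; have M0R : M%:R != 0 :> R by rewrite pnatr_eq0; lia.
have M0C : M%:R != 0 :> R[i] by rewrite pnatr_eq0; lia.
have Mpred : M = M.-1.+1 by lia.
pose s : seq R := [seq i%:R / M%:R | i <- iota 0 M].
pose c (j : nat) : R[i] :=
  if (j < M.-1)%N then expi (j%:R * x) else expi (((n * M)%N%:Z - 1)%:~R * x).
have sum_s (V : nmodType) (F : R -> V) : \sum_(t <- s) F t = \sum_(i < M) F (i%:R / M%:R).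
  rewrite big_map -[X in iota 0 X](subn0 M) -/(index_iota 0 M) big_mkord//.
have sum_iota (V : nmodType) (F : nat -> V) :
    \sum_(j <- iota 0 M) F j = \sum_(j < M.-1) F j + F M.-1.
  by rewrite {1}Mpred -[X in iota 0 X](subn0 M.-1.+1) -/(index_iota 0 M.-1.+1) big_mkord big_ord_recr.
have maskE i : mask M n (x + i%:R / M%:R) =
    (\sum_(j <- iota 0 M) c j * expi (j%:R * (i%:R / M%:R))) / M%:R.
  rewrite /mask big_digit_seq; congr (_ / _).
  rewrite sum_iota; congr (_ + _).
    by apply: eq_bigr => j _; rewrite /c ltn_ord mulrDr expiD -pmulrn.
  rewrite /c ltnn mulrDr expiD; congr (_ * _).
  by rewrite expi_last_digit// mulrCA divff// mulr1 natr_int.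
have orth : {in iota 0 M &, forall j k : nat,
    inner s (fun t => expi (j%:R * t)) (fun t => expi (k%:R * t)) = (j == k)%:R}.
  move=> j k; rewrite !mem_iota !add0n/= => jM kM.
  rewrite /inner /mean size_map size_iota sum_s.
  under eq_bigr => i _ do rewrite -expiN -expiD -mulNr -mulrDl mulrCA expiMn.
  have [->|jk] := eqVneq j k.
    by under eq_bigr do rewrite subrr mul0r expi0 expr1n; rewrite sumr_const card_ord divff.
  rewrite geometric_root_of_unity ?mul0r//; last first.
    by rewrite -expiMn mulrCA divff// mulr1 expi_int//; apply: rpredB; exact: natr_int.
  apply/eqP => /expi_eq1/intrP[m] /(congr1 (fun t => t * M%:R)).
  rewrite divfK// => /eqP.
  have -> : j%:R - k%:R = (j%:Z - k%:Z)%:~R :> R by rewrite intrD mulrNz -!pmulrn.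
  have -> : m%:~R * M%:R = (m * M%:Z)%:~R :> R by rewrite intrM -pmulrn.
  rewrite eqr_int => /eqP jkE.
  have [m0|[m1|m1]] : m = 0 \/ 1 <= m \/ m <= -1 by lia.
  - by move: jkE jk; rewrite m0; lia.
  - by nia.
  - by nia.
have := mean_nsq_lincomb (e := fun j t => expi (j%:R * t)) (iota_uniq 0 M) orth c.
rewrite /mean sum_s size_map size_iota => E.
transitivity ((\sum_(i < M) nsq (\sum_(j <- iota 0 M) c j * expi (j%:R * (i%:R / M%:R)))) / M%:R / M%:R).
  rewrite !mulr_suml; apply: eq_bigr => i _; rewrite maskE nsqM.
  have -> : (M%:R : R[i])^-1 = (M%:R^-1)%:C%C by rewrite fmorphV/= rmorph_nat.
  by rewrite nsq_real expr2 mulrA.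
rewrite E (eq_bigr (fun=> 1)) ?sumr_const_seq; last first.
  by move=> j _; rewrite /c; case: ifP => _; rewrite nsq_expi.
by rewrite big_const_seq count_predT size_iota iter_addr addr0 divff.
Qed.

End mask.

(** * A lower bound for the masks near the origin *)

Section mask_lower.
Context {R : realType}.
Implicit Types (x t : R) (M n : nat).

Lemma normr_sin_le t : `|sin t| <= `|t|.
Proof.
have pos (u : R) : 0 <= u -> `|sin u| <= u.
  move=> u0; have [c _] := MVT_segment u0 (f := @sin R) (df := @cos R) (fun (x : R) _ => is_derive_sin x)
    (continuous_subspaceT (@continuous_sin R)).
  rewrite sin0 !subr0 => ->; rewrite normrM (ger0_norm u0) ler_piMl//.
  exact: cos_max.
have [t0|t0] := leP 0 t; first by rewrite (ger0_norm t0) pos.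
by rewrite (ltr0_norm t0) -[X in X <= _]normrN -sinN pos// oppr_ge0 ltW.
Qed.

Lemma cos_ge_quadratic t : 1 - t ^+ 2 / 2 <= cos t.
Proof.
have -> : t = (t / 2) *+ 2 by rewrite -mulr_natr divfK.
rewrite cos_mulr2n cos2sin2.
have : sin (t / 2) ^+ 2 <= (t / 2) ^+ 2.
  by have := normr_sin_le (t / 2); rewrite -ler_sqr ?nnegrE// !real_normK ?num_real.
by rewrite -[(1 - _) *+ 2]mulr_natr; lra.
Qed.

Lemma Re_le_normc (z : R[i]) : complex.Re z <= Normc.normc z.
Proof.
case: z => a b /=; apply: le_trans (ler_norm a) _.
by rewrite -sqrtr_sqr ler_wsqrtr// lerDl sqr_ge0.
Qed.

Lemma normc_ge0 (z : R[i]) : 0 <= Normc.normc z.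
Proof. by case: z => a b; exact: sqrtr_ge0. Qed.

Lemma normc_expi t : Normc.normc (expi t) = 1.
Proof.
by rewrite -[LHS]ger0_norm ?sqrtr_ge0// -sqrtr_sqr -nsq_normc nsq_expi sqrtr1.
Qed.

Lemma sum_centered_squares m :
  \sum_(j < m) (j%:R - (m%:R - 1) / 2) ^+ 2 = m%:R * (m%:R ^+ 2 - 1) / 12 :> R.
Proof.
suff gen (c : R) : \sum_(j < m) (j%:R - c) ^+ 2 =
    m%:R * (m%:R - 1) * (2 * m%:R - 1) / 6 - c * m%:R * (m%:R - 1) + m%:R * c ^+ 2.
  by rewrite gen; field.
elim: m => [|m IH]; first by rewrite big_ord0; ring.
by rewrite big_ord_recr/= IH -natr1; field.
Qed.

(** After centring, the regular digits contribute the cosines of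
    2 pi (j - (M - 2) / 2) x, bounded below by their quadratic minorants, while
    the last digit costs at most 1 / M. *)
Lemma mask_lower M n x : (0 < M)%N ->
  1 - 8 / 3 * (M%:R * x) ^+ 2 - 2 / M%:R <= Normc.normc (mask M n x).
Proof.
move=> M0; have M0R : 0 < M%:R :> R by rewrite ltr0n.
have M0C : M%:R != 0 :> R[i] by rewrite pnatr_eq0; lia.
set m := M.-1; have mM : m%:R = M%:R - 1 :> R.
  by rewrite /m -subn1 natrB.
pose c : R := (m%:R - 1) / 2.
have -> : Normc.normc (mask M n x) = Normc.normc (M%:R * (mask M n x * expi (- c * x))) / M%:R.
  rewrite !Normc.normcM normc_expi mulr1.
  have -> : Normc.normc (M%:R : R[i]) = M%:R.
    by rewrite -[M%:R](rmorph_nat (real_complex R)) /= expr0n addr0 sqrtr_sqr ger0_norm.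
  by rewrite [RHS]mulrAC divff ?mul1r// gt_eqF.
rewrite ler_pdivlMr//; apply: le_trans (Re_le_normc _).
have -> : M%:R * (mask M n x * expi (- c * x)) =
    \sum_(j < m) expi ((j%:R - c) * x) +
    expi (((n * M)%N%:Z - 1)%:~R * x - c * x).
  rewrite /mask mulrA [X in X * _]mulrC divfK//.
  rewrite big_digit_seq mulrDl mulr_suml -expiD mulNr; congr (_ + _).
  by apply: eq_bigr => j _; rewrite -expiD -pmulrn mulrBl.
rewrite raddfD raddf_sum/=.
apply: (@le_trans _ _ (\sum_(j < m) (1 - (2 * pi * ((j%:R - c) * x)) ^+ 2 / 2) - 1)); last first.
  by apply: lerD; [apply: ler_sum => j _; exact: cos_ge_quadratic|exact: cos_geN1].
have -> : \sum_(j < m) (1 - (2 * pi * ((j%:R - c) * x)) ^+ 2 / 2) =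
   m%:R - 2 * pi ^+ 2 * x ^+ 2 * (m%:R * (m%:R ^+ 2 - 1) / 12) :> R.
  rewrite -sum_centered_squares mulr_sumr sumrB sumr_const card_ord; congr (_ - _).
  by apply: eq_bigr => j _; rewrite /c; field.
have pi16 : (pi : R) ^+ 2 <= 16.
  by have := @pi_ge0 R; have := @pihalf_lt2 R; nra.
have -> : (1 - 8 / 3 * (M%:R * x) ^+ 2 - 2 / M%:R) * M%:R =
    M%:R - 2 - 8 / 3 * x ^+ 2 * M%:R ^+ 3 by field; rewrite gt_eqF.
have h : m%:R * (m%:R ^+ 2 - 1) <= M%:R ^+ 3 :> R.
  have : 0 <= m%:R :> R by []. 
  by rewrite mM; nra.
have h0 : 0 <= m%:R * (m%:R ^+ 2 - 1) :> R.
  rewrite /m; case: (M.-1) => [|k]; first by rewrite mul0r.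
  by rewrite mulr_ge0// subr_ge0 -natrX ler1n expn_gt0.
have : pi ^+ 2 * (m%:R * (m%:R ^+ 2 - 1)) <= 16 * M%:R ^+ 3 :> R.
  by apply: ler_pM; rewrite ?sqr_ge0.
move=> /(ler_wpM2l (sqr_ge0 x)); rewrite mM; lra.
Qed.
End mask_lower.

(** * Finite convolutions and their transforms *)

Section levels.
Context {R : realType}.
Variables (N M n : nat -> nat).

(** The common denominator of the points of the first [k] levels. *)
Definition scale k : nat := \prod_(1 <= j < k.+1) N j.

Definition level k : seq R :=
  [seq (scale k)%:R^-1 * b%:~R | b <- digit_seq (M k) (n k)].

(** The sums of one element of each level from [K + 1] to [K + d], with
    multiplicity: the average over this list is the integral against the convolution
    of these levels. *)
Fixpoint points K d : seq R :=
  if d is d'.+1 then [seq x + a | x <- points K d', a <- level (K + d)] else [:: 0].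

Definition transform K d (x : R) : R[i] := mean (points K d) (fun t => expi (x * t)).

(** The zeros of the mask of level [k], in the variable of the transform. *)
Definition zero_at k (x : R) : Prop :=
  (M k)%:R * (x / (scale k)%:R) \is a Num.int /\ x / (scale k)%:R \isn't a Num.int.

Hypothesis HNM : forall k, (1 <= k)%N -> (3 <= M k <= N k)%N.
Hypothesis Hodd : forall k, (1 <= k)%N -> odd (M k).

Lemma scale0 : scale 0 = 1%N.
Proof. by rewrite /scale big_geq. Qed.

Lemma scaleS k : scale k.+1 = (scale k * N k.+1)%N.
Proof. by rewrite /scale big_nat_recr. Qed.

Lemma M_ge3 k : (3 <= M k.+1)%N. Proof. by have /andP[] := HNM (isT : (0 < k.+1)%N). Qed.
Lemma M_gt0 k : (0 < M k.+1)%N. Proof. exact: leq_trans (M_ge3 k). Qed.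
Lemma M_leN k : (M k.+1 <= N k.+1)%N. Proof. by have /andP[] := HNM (isT : (0 < k.+1)%N). Qed.
Lemma N_ge3 k : (3 <= N k.+1)%N. Proof. exact: leq_trans (M_ge3 k) (M_leN k). Qed.

Lemma scale_gt0 k : (0 < scale k)%N.
Proof.
elim: k => [|k IH]; first by rewrite scale0.
by rewrite scaleS muln_gt0 IH (leq_trans _ (N_ge3 k)).
Qed.

Lemma scaleR_gt0 k : 0 < (scale k)%:R :> R. Proof. by rewrite ltr0n scale_gt0. Qed.

Lemma scale_exp K i : (scale K * 3 ^ i <= scale (K + i))%N.
Proof.
elim: i => [|i IH]; first by rewrite addn0 muln1.
by rewrite addnS scaleS expnSr mulnA leq_mul// N_ge3.
Qed.

Lemma scale_dvd K i : (scale K %| scale (K + i))%N.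
Proof.
elim: i => [|i IH]; first by rewrite addn0.
by rewrite addnS scaleS dvdn_mulr.
Qed.

Lemma scale_large (c : R) : exists K0, forall K, (K0 <= K)%N -> c <= (scale K)%:R.
Proof.
exists (Num.truncn `|c|).+1 => K cK.
apply: (le_trans (ler_norm c)); apply: (@le_trans _ _ (Num.truncn `|c|).+1%:R).
  by rewrite ltW// truncnS_gt.
rewrite ler_nat (leq_trans cK)// -[K in scale K]add0n (leq_trans _ (scale_exp 0 K))//.
by rewrite scale0 mul1n ltnW// ltn_expl.
Qed.

Lemma size_level k : size (level k.+1) = M k.+1.
Proof. by rewrite size_map size_digit_seq// M_gt0. Qed.

Lemma points_neq_nil K d : points K d != [::].
Proof.
rewrite -size_eq0; elim: d => // d IH; rewrite /= size_allpairs muln_eq0 negb_or IH.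
by rewrite addnS size_level gtn_eqF// M_gt0.
Qed.

Lemma size_points K d : size (points K d) = (\prod_(i < d) M (K + i.+1))%N.
Proof.
by elim: d => [|d IH]; rewrite ?big_ord0// big_ord_recr/= size_allpairs IH addnS size_level.
Qed.

Lemma mean_points_add {F : fieldType} K d (f : R -> F) :
  mean (points 0 (K + d)) f =
  mean (points 0 K) (fun x => mean (points K d) (fun y => f (x + y))).
Proof.
elim: d f => [|d IH] f.
  rewrite addn0; apply: eq_mean => x _.
  by rewrite /mean big_seq1 addr0 divr1.
rewrite addnS /= mean_sumset IH; apply: eq_mean => x _.
rewrite mean_sumset; apply: eq_mean => y _; rewrite !add0n addnS.
by apply: eq_mean => z _; rewrite addrA.
Qed.

Lemma mean_level k (x : R) :
  mean (level k.+1) (fun t => expi (x * t)) = mask (M k.+1) (n k.+1) (x / (scale k.+1)%:R).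
Proof.
rewrite /mean size_level big_map /mask; congr (_ / _); apply: eq_bigr => b _.
by congr expi; rewrite mulrA mulrC.
Qed.

Lemma transformS K d x : transform K d.+1 x =
  transform K d x * mask (M (K + d).+1) (n (K + d).+1) (x / (scale (K + d).+1)%:R).
Proof.
rewrite /transform /= mean_sumset addnS -mean_level mulrC -meanZ.
apply: eq_mean => t _; rewrite mulrC -meanZ; apply: eq_mean => a _.
by rewrite mulrDr expiD.
Qed.

Lemma transform0 K x : transform K 0 x = 1.
Proof. by rewrite /transform /mean big_seq1 mulr0 expi0 divr1. Qed.

Lemma transform_add K d x : transform 0 (K + d) x = transform 0 K x * transform K d x.
Proof.
elim: d => [|d IH]; first by rewrite addn0 transform0 mulr1.
by rewrite addnS transformS IH add0n [in RHS]transformS mulrA.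
Qed.

Lemma mask_level_eq0 k x :
  mask (M k.+1) (n k.+1) (x / (scale k.+1)%:R) = 0 <-> zero_at k.+1 x.
Proof. by apply: mask_eq0P; [exact: Hodd|exact: M_ge3]. Qed.

Lemma transform_eq0P K d x :
  transform K d x = 0 <-> exists2 k, (K < k <= K + d)%N & zero_at k x.
Proof.
elim: d => [|d IH].
  rewrite transform0; split=> [/eqP|[k]]; first by rewrite oner_eq0.
  by rewrite addn0; lia.
rewrite transformS; split.
  move=> /eqP; rewrite mulf_eq0 => /orP[] /eqP.
    by move=> /IH[k kKd zk]; exists k => //; lia.
  by move=> /mask_level_eq0 zk; exists (K + d).+1 => //; lia.
move=> [k kKd zk]; have [kd|kd] := leqP k (K + d).
  suff -> : transform K d x = 0 by rewrite mul0r.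
  by apply/IH; exists k => //; lia.
have kE : k = (K + d).+1 by lia.
by rewrite (mask_level_eq0 (K + d) x).2 ?mulr0// -kE.
Qed.

(** As soon as one of the lower bounds becomes negative, the nonnegativity of the
    product takes over. *)
Lemma prod_ge_1Bsum d (a delta : nat -> R) :
  (forall i, 0 <= a i) -> (forall i, 0 <= delta i) -> (forall i, 1 - delta i <= a i) ->
  1 - \sum_(i < d) delta i <= \prod_(i < d) a i.
Proof.
move=> a0 d0 ad; elim: d => [|d IH]; first by rewrite !big_ord0 subr0.
rewrite !big_ord_recr/=; set S := \sum_(i < d) _; set A := \prod_(i < d) _.
have A0 : 0 <= A by apply: prodr_ge0.
have S0 : 0 <= S by apply: sumr_ge0.
have [S1|S1] := leP (1 - S) 0.
  by apply: le_trans (mulr_ge0 A0 (a0 d)); have := d0 d; lra.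
have [D1|D1] := leP (1 - delta d) 0.
  by apply: le_trans (mulr_ge0 A0 (a0 d)); lra.
apply: (@le_trans _ _ ((1 - S) * (1 - delta d))); first by have := d0 d; nra.
by apply: ler_pM => //; exact: ltW.
Qed.

Lemma normc_transform K d x :
  Normc.normc (transform K d x) =
  \prod_(i < d) Normc.normc (mask (M (K + i).+1) (n (K + i).+1) (x / (scale (K + i).+1)%:R)).
Proof.
elim: d => [|d IH].
  by rewrite transform0 big_ord0 -(expi0 (R := R)) normc_expi.
by rewrite transformS Normc.normcM IH big_ord_recr.
Qed.

Lemma sum_geometric9 d : \sum_(i < d) (9%:R ^- i) <= 9 / 8 :> R.
Proof.
suff -> : \sum_(i < d) (9%:R ^- i) = 9 / 8 * (1 - 9%:R ^- d) :> R.
  rewrite ler_piMr// lerBlDr lerDl invr_ge0 exprn_ge0//.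
elim: d => [|d IH]; first by rewrite big_ord0 expr0 invr1 subrr mulr0.
rewrite big_ord_recr/= IH exprS; field.
by rewrite expf_neq0.
Qed.

(** The argument of the [i]-th mask of the tail, multiplied by its number of digits, is
    at most [11 / 20 * 3 ^- i].  By [mask_lower] the masks then fall short of 1 by at
    most [121 / 150 * 9 ^- i + 2 / M], and these losses add up to less than 19 / 20. *)
Lemma transform_lower K d x :
  \sum_(i < d) ((M (K + i).+1)%:R)^-1 <= 1 / 50 :> R ->
  `|x| <= 11 / 20 * (scale K)%:R ->
  1 / 20 <= Normc.normc (transform K d x).
Proof.
move=> Msum xK; rewrite normc_transform.
pose delta i : R := 121 / 150 * 9%:R ^- i + 2 / (M (K + i).+1)%:R.
have delta0 i : 0 <= delta i.
  by rewrite addr_ge0 ?mulr_ge0 ?invr_ge0 ?exprn_ge0.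
apply: le_trans (_ : 1 - \sum_(i < d) delta i <= _); last first.
  apply: (@prod_ge_1Bsum d (fun i => Normc.normc
    (mask (M (K + i).+1) (n (K + i).+1) (x / (scale (K + i).+1)%:R)))) => //.
    by move=> i; exact: normc_ge0.
  move=> i; apply: le_trans (mask_lower _ _ (M_gt0 (K + i))).
  rewrite /delta opprD addrA lerD2r lerD2l lerN2.
  set y := (M (K + i).+1)%:R * (x / (scale (K + i).+1)%:R).
  suff : y ^+ 2 <= (11 / 20 * 3%:R ^- i) ^+ 2.
    have e9 : (3%:R ^- i) ^+ 2 = 9%:R ^- i :> R.
      by rewrite exprVn -exprM mulnC exprM -natrX.
    by rewrite [(11 / 20 * _) ^+ 2]exprMn e9; lra.
  rewrite -[leLHS]real_normK ?num_real// ler_sqr ?nnegrE// /y.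
  rewrite normrM normrM normfV !normr_nat.
  have N0 : 0 < (N (K + i).+1)%:R :> R by rewrite ltr0n (leq_trans _ (N_ge3 (K + i))).
  have P0 := scaleR_gt0 (K + i).
  rewrite mulrA ler_pdivrMr ?scaleR_gt0// scaleS natrM.
  have MN : (M (K + i).+1)%:R <= (N (K + i).+1)%:R :> R by rewrite ler_nat M_leN.
  have sK : (scale K)%:R * 3%:R ^+ i <= (scale (K + i))%:R :> R.
    by rewrite -natrX -natrM ler_nat scale_exp.
  have T0 : 0 < 3%:R ^+ i :> R by rewrite exprn_gt0.
  have hx : `|x| <= 11 / 20 * 3%:R ^- i * (scale (K + i))%:R.
    apply: (le_trans xK); rewrite -[leRHS]mulrA ler_wpM2l//.
    by rewrite mulrC ler_pdivlMr.
  by rewrite mulrA [leRHS]mulrC ler_pM.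
rewrite big_split/= -!mulr_sumr.
by have := sum_geometric9 d; lra.
Qed.

Lemma small_tails (eps : R) : 0 < eps ->
  (\sum_(1 <= k <oo) (((M k)%:R : R)^-1)%:E < +oo)%E ->
  exists K0, forall K d, (K0 <= K)%N -> \sum_(i < d) ((M (K + i).+1)%:R)^-1 <= eps :> R.
Proof.
move=> eps0 Hsum.
pose S m : R := \sum_(1 <= k < m) ((M k)%:R)^-1.
have Sinc : nondecreasing_seq S.
  apply/nondecreasing_seqP => -[|m]; first by rewrite /S !big_geq.
  by rewrite /S [leRHS]big_nat_recr//= lerDl invr_ge0.
have Scvg : cvgn S.
  apply: nondecreasing_is_cvgn => //.
  exists (fine (\sum_(1 <= k <oo) (((M k)%:R : R)^-1)%:E)%E) => _ [m _ <-].
  rewrite -lee_fin fineK; last first.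
    by rewrite ge0_fin_numE// nneseries_ge0// => k _ _; rewrite lee_fin invr_ge0.
  rewrite /S -sumEFin.
  by apply: nneseries_lim_ge => k _ _; rewrite lee_fin invr_ge0.
have [K0 _ HK0] : \forall m \near \oo, limn S - eps < S m.
  by apply: (cvgr_gt (limn S)) => //; rewrite ltrBlDr ltrDl.
exists K0 => K d K0K.
have -> : \sum_(i < d) ((M (K + i).+1)%:R)^-1 = S (K + d).+1 - S K.+1.
  rewrite /S (@big_cat_nat _ _ _ K.+1 1 (K + d).+1)//=; last by rewrite ltnS leq_addr.
  rewrite addrAC subrr add0r -{1}[K.+1]add0n big_addn subSS addKn big_mkord.
  by apply: eq_bigr => i _; rewrite addnS addnC.
have h1 := HK0 K.+1 (leqW K0K).
have h2 := nondecreasing_cvgn_le Sinc Scvg (K + d).+1.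
by rewrite lerBlDr; apply: le_trans h2 _; rewrite addrC -lerBlDr ltW.
Qed.

End levels.

(** * Integrals against finite convolutions *)

Section convolution_integral.
Context {R : realType}.
Local Open Scope ereal_scope.

Lemma integral_uniform_fset (A : {fset R}) (g : R -> R) :
  measurable_fun setT g -> (forall x, 0 <= g x)%R ->
  \int[uniform_fset A]_x (g x)%:E = (mean (enum_fset A) g)%:E.
Proof.
move=> mg g0.
pose c : {nonneg R} := NngNum (eqbRL (invr_ge0 _) (ler0n R #|` A|)).
pose diracs (k : nat) : {measure set R -> \bar R} := \d_(nth 0%R A k).
have mEg : measurable_fun setT (EFin \o g) by exact/measurable_EFinP.
rewrite (eq_measure_integral (mscale c (msum diracs #|` A|))); last first.
  move=> U mU _ /=; rewrite /uniform_fset /mscale /= /msum; congr (_ * _).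
  by rewrite (big_nth 0%R) big_mkord.
rewrite ge0_integral_mscale//; last by move=> x _; rewrite lee_fin.
rewrite ge0_integral_measure_sum//; last by move=> x _; rewrite lee_fin.
rewrite /mean mulrC EFinM (big_nth 0%R) big_mkord -sumEFin /=; congr (_ * _).
by apply: eq_bigr => i _; rewrite integral_dirac// diracT mul1e.
Qed.

Lemma integral_convolution (mu nu : {finite_measure set R -> \bar R}) (g : R -> R) :
  measurable_fun setT g -> (forall x, 0 <= g x)%R ->
  \int[convolution mu nu]_x (g x)%:E =
  \int[mu]_x \int[nu]_y (g (x + y)%R)%:E.
Proof.
move=> mg g0.
have madd : measurable_fun [set: R * R] (fun p : R * R => (p.1 + p.2)%R).
  exact: measurable_funD.
have mEg : measurable_fun setT (EFin \o g) by exact/measurable_EFinP.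
rewrite (eq_measure_integral (pushforward (mu \x nu) (fun p : R * R => (p.1 + p.2)%R)))//.
rewrite ge0_integral_pushforward//; last first.
  by move=> x _; rewrite lee_fin.
rewrite preimage_setT fubini_tonelli1//.
- exact: measurableT_comp.
- by move=> x; rewrite lee_fin.
Qed.

Lemma measurable_mean_shift (s : seq R) (g : R -> R) :
  measurable_fun setT g ->
  measurable_fun setT (fun x : R => mean s (fun y => g (x + y)%R)).
Proof.
move=> mg; apply: measurable_funM => //; apply: measurable_sum => y.
by apply: (measurableT_comp mg); exact: measurable_funD.
Qed.

Variables (N M n : nat -> nat) (B : nat -> {fset int}).
Hypothesis HNM : forall k, (1 <= k)%N -> (3 <= M k <= N k)%N.
Hypothesis HB : forall k, (1 <= k)%N -> B k = digits (M k) (n k).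

Lemma perm_scaled_digits k :
  perm_eq (enum_fset (@scaled_digits R N B k.+1)) (level N M n k.+1).
Proof.
have P0 := scaleR_gt0 (R := R) HNM k.+1.
have inj : injective (fun b : int => ((scale N k.+1)%:R^-1 * b%:~R : R)%R).
  move=> a b /(mulfI _); rewrite invr_eq0 gt_eqF// => /(_ isT)/eqP.
  by rewrite eqr_int => /eqP.
apply: uniq_perm => //.
  by rewrite map_inj_uniq// digit_seq_uniq// (M_gt0 HNM).
move=> x; apply/imfsetP/mapP => - [b /=]; rewrite HB// => bB ->; exists b => //.
  by rewrite -(perm_mem (perm_digits _ (M_gt0 HNM k))).
by rewrite (perm_mem (perm_digits _ (M_gt0 HNM k))).
Qed.

Lemma ge0_integral_finite_convolution m (g : R -> R) :
  measurable_fun setT g -> (forall x, 0 <= g x)%R ->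
  \int[finite_convolution N B m]_x (g x)%:E = (mean (points N M n 0 m) g)%:E.
Proof.
elim: m g => [|m IH] g mg g0.
  rewrite integral_dirac//; last exact/measurable_EFinP.
  by rewrite diracT mul1e /mean big_seq1 divr1.
rewrite /= integral_convolution//.
under eq_integral => x _.
  rewrite (integral_uniform_fset _ (g := fun y => g (x + y)%R)); [|by apply: (measurableT_comp mg); exact: measurable_funD|by []].
  rewrite (perm_mean _ (perm_scaled_digits m)).
  over.
rewrite IH; [|exact: measurable_mean_shift|by move=> x; exact: mean_ge0].
by rewrite mean_sumset.
Qed.

Lemma integral_finite_convolution m (g : R -> R) : measurable_fun setT g ->
  \int[finite_convolution N B m]_x (g x)%:E = (mean (points N M n 0 m) g)%:E.
Proof.
move=> mg; rewrite integralE.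
have pE : (EFin \o g)^\+ = EFin \o (fun x => Num.max (g x) 0)%R.
  by apply/funext => x; rewrite funeposE /= EFin_max.
have nE : (EFin \o g)^\- = EFin \o (fun x => Num.max (- g x) 0)%R.
  by apply/funext => x; rewrite funenegE /= EFin_max.
rewrite pE nE !ge0_integral_finite_convolution.
- rewrite -EFinB; congr EFin; rewrite -meanN -meanD; apply: eq_mean => x _.
  by case: (leP (g x) 0%R) => gx; case: (leP (- g x)%R 0%R) => ngx; lra.
- by apply: measurable_maxr => //; exact: measurable_funN.
- by move=> x; rewrite le_max lexx orbT.
- exact: measurable_maxr.
- by move=> x; rewrite le_max lexx orbT.
Qed.

Lemma mean_cvg_integral (mu : probability R R) (g : R -> R) :
  infinite_convolution N B mu -> continuous g -> (exists C, forall x, `|g x| <= C)%R ->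
  mean (points N M n 0 m) g @[m --> \oo] --> (\int[mu]_x g x)%R.
Proof.
move=> Hmu cg bg.
have mg : measurable_fun setT g by exact: continuous_measurable_fun.
have := Hmu g cg bg.
under eq_fun do rewrite integral_finite_convolution//.
have gi : mu.-integrable setT (EFin \o g).
  have [C gC] := bg; apply: (@le_integrable _ _ _ mu _ measurableT _ (EFin \o cst C)).
  - exact/measurable_EFinP.
  - by move=> x _ /=; rewrite lee_fin (le_trans (gC x))// ler_norm.
  - by apply/finite_measure_integrable_cst.
rewrite -(fineK (integrable_fin_num measurableT gi)).
by move/fine_cvgP => [_].
Qed.

End convolution_integral.

(** * Bounded continuous functions and the Fourier transform of the limit *)

Section L2norm.
Context {R : realType} (mu : probability R R).
Local Open Scope ereal_scope.

Lemma L2norm_sqr (f : R -> R[i]) :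
  L2norm mu f `^ 2 = \int[mu]_x (nsq (f x))%:E.
Proof.
rewrite /L2norm poweR_Lnorm//; apply: eq_integral => x _.
rewrite /= ger0_norm ?normc_ge0// powR_mulrn ?normc_ge0//.
by rewrite nsq_normc.
Qed.

Lemma L2norm_ltP (f : R -> R[i]) (eps : R) : (0 < eps)%R ->
  L2norm mu f < eps%:E <-> \int[mu]_x (nsq (f x))%:E < (eps ^+ 2)%:E.
Proof.
move=> eps0; rewrite -L2norm_sqr.
have := Lnorm_ge0 mu 2%:E (EFin \o (fun x => Normc.normc (f x))).
rewrite -/(L2norm mu f); case: (L2norm mu f) => [r r0|_|//]; last by rewrite poweRyr//.
rewrite lee_fin in r0; rewrite poweR_EFin powR_mulrn// !lte_fin.
rewrite ltr_pXn2r ?nnegrE ?(ltW eps0)//.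
Qed.

Lemma L2norm_ltyP (f : R -> R[i]) :
  L2norm mu f < +oo <-> \int[mu]_x (nsq (f x))%:E < +oo.
Proof.
rewrite -L2norm_sqr.
have := Lnorm_ge0 mu 2%:E (EFin \o (fun x => Normc.normc (f x))).
rewrite -/(L2norm mu f); case: (L2norm mu f) => [r r0|_|//]; last by rewrite poweRyr//.
by rewrite poweR_EFin !ltry.
Qed.

End L2norm.

Section bounded_continuous.
Context {R : realType}.
Implicit Types (f g : R -> R[i]) (u v : R -> R).

Definition bcont u := continuous u /\ exists C, forall x, `|u x| <= C.

Lemma bcont_cst c : bcont (fun=> c).
Proof. by split; [exact: cst_continuous|exists `|c|]. Qed.

Lemma bcontD u v : bcont u -> bcont v -> bcont (fun x => u x + v x).
Proof.
move=> [cu [C uC]] [cv [D vD]]; split.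
  by move=> x; apply: continuousD; [exact: cu|exact: cv].
by exists (C + D) => x; rewrite (le_trans (ler_normD _ _))// lerD.
Qed.

Lemma bcontM u v : bcont u -> bcont v -> bcont (fun x => u x * v x).
Proof.
move=> [cu [C uC]] [cv [D vD]]; split.
  by move=> x; apply: continuousM; [exact: cu|exact: cv].
by exists (C * D) => x; rewrite normrM ler_pM.
Qed.

Lemma bcontN u : bcont u -> bcont (fun x => - u x).
Proof.
move=> [cu [C uC]]; split; last by exists C => x; rewrite normrN.
by move=> x; apply: continuousN; exact: cu.
Qed.

Lemma bcont_cos (a : R) : bcont (fun x => cos (a * x)).
Proof.
split; last by exists 1 => x; exact: cos_max.
move=> x; apply: continuous_comp; last exact: continuous_cos.
by apply: continuousM; [exact: cst_continuous|exact: cvg_id].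
Qed.

Lemma bcont_sin (a : R) : bcont (fun x => sin (a * x)).
Proof.
split; last by exists 1 => x; exact: sin_max.
move=> x; apply: continuous_comp; last exact: continuous_sin.
by apply: continuousM; [exact: cst_continuous|exact: cvg_id].
Qed.

Definition cbcont f :=
  bcont (fun x => complex.Re (f x)) /\ bcont (fun x => complex.Im (f x)).

Lemma cbcont_nsq f : cbcont f -> bcont (fun x => nsq (f x)).
Proof. by move=> [fr fi]; apply: bcontD; apply: bcontM. Qed.

Lemma cbcontD f g : cbcont f -> cbcont g -> cbcont (fun x => f x + g x).
Proof.
move=> [fr fi] [gr gi]; split.
  by under eq_fun do rewrite raddfD; exact: bcontD.
by under eq_fun do rewrite raddfD; exact: bcontD.
Qed.

Lemma cbcontN f : cbcont f -> cbcont (fun x => - f x).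
Proof.
move=> [fr fi]; split.
  by under eq_fun do rewrite raddfN; exact: bcontN.
by under eq_fun do rewrite raddfN; exact: bcontN.
Qed.

Lemma cbcontM f g : cbcont f -> cbcont g -> cbcont (fun x => f x * g x).
Proof.
move=> [fr fi] [gr gi]; split.
  rewrite (_ : (fun x => _) = fun x => complex.Re (f x) * complex.Re (g x) +
     - (complex.Im (f x) * complex.Im (g x))).
    by apply: bcontD; [exact: bcontM|apply: bcontN; exact: bcontM].
  by apply/funext => x; case: (f x) (g x) => a b [c d].
rewrite (_ : (fun x => _) = fun x => complex.Re (f x) * complex.Im (g x) +
   (complex.Im (f x) * complex.Re (g x))).
  by apply: bcontD; exact: bcontM.
by apply/funext => x; case: (f x) (g x) => a b [c d].
Qed.

Lemma cbcont_real u : bcont u -> cbcont (fun x => (u x)%:C%C).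
Proof. by move=> bu; split=> //=; exact: bcont_cst. Qed.

Lemma cbcont_cst (c : R[i]) : cbcont (fun=> c).
Proof. by split; exact: bcont_cst. Qed.

Lemma cbcont_expi (l : R) : cbcont (fun x => expi (l * x)).
Proof.
split => /=; under eq_fun do rewrite mulrA.
  exact: bcont_cos.
by apply: bcontN; exact: bcont_sin.
Qed.

Lemma cbcont_lincomb (I : Type) (r : seq I) (c : I -> R[i]) (l : I -> R) :
  cbcont (fun x => \sum_(i <- r) c i * expi (l i * x)).
Proof.
elim: r => [|i r IH].
  by under eq_fun do rewrite big_nil; exact: cbcont_cst.
under eq_fun do rewrite big_cons; apply: cbcontD => //.
by apply: cbcontM; [exact: cbcont_cst|exact: cbcont_expi].
Qed.

Lemma bcont_integrable (mu : probability R R) u :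
  bcont u -> mu.-integrable setT (EFin \o u).
Proof.
move=> [cu [C uC]].
have mg : measurable_fun setT u by exact: continuous_measurable_fun.
apply: (@le_integrable _ _ _ mu _ measurableT _ (EFin \o cst C)).
- exact/measurable_EFinP.
- by move=> x _ /=; rewrite lee_fin (le_trans (uC x))// ler_norm.
- by apply/finite_measure_integrable_cst.
Qed.

Lemma bcont_integralE (mu : probability R R) u :
  bcont u -> (\int[mu]_x (u x)%:E = (\int[mu]_x u x)%:E)%E.
Proof.
by move=> bu; rewrite fineK//; apply: integrable_fin_num => //; exact: bcont_integrable.
Qed.

End bounded_continuous.

Section fourier.
Context {R : realType} (mu : probability R R).

Lemma characterE (l x : R) : character l x = expi (l * x).
Proof. by rewrite /character /expi mulrA. Qed.

Definition fourier (x : R) : R[i] := L2inner mu (fun t => expi (x * t)) (fun=> 1).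

Lemma L2inner_expi (l l' : R) :
  L2inner mu (character l) (character l') = fourier (l - l').
Proof.
congr Complex; apply: eq_Rintegral => x _; rewrite !characterE.
  by rewrite -expiN -expiD conjc1 mulr1 mulrBl.
by rewrite -expiN -expiD conjc1 mulr1 mulrBl.
Qed.

Variables (N M n : nat -> nat) (B : nat -> {fset int}).
Hypothesis HNM : forall k, (1 <= k)%N -> (3 <= M k <= N k)%N.
Hypothesis Hodd : forall k, (1 <= k)%N -> odd (M k).
Hypothesis HB : forall k, (1 <= k)%N -> B k = digits (M k) (n k).
Hypothesis Hmu : infinite_convolution N B mu.
Hypothesis Hsum : (\sum_(1 <= k <oo) (((M k)%:R : R)^-1)%:E < +oo)%E.
Local Notation points := (points N M n).
Local Notation transform := (transform N M n).

Lemma mean_cvg (u : R -> R) : bcont u ->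
  mean (points 0 m) u @[m --> \oo] --> \int[mu]_x u x.
Proof. by move=> [cu bu]; exact: mean_cvg_integral HNM HB mu u Hmu cu bu. Qed.

(** Weak convergence is applied to the cosine and to the sine. *)
Lemma Re_transform_cvg x :
  complex.Re (transform 0 m x) @[m --> \oo] --> complex.Re (fourier x).
Proof.
under eq_fun do rewrite /transform Re_mean.
have -> : complex.Re (fourier x) = \int[mu]_t complex.Re (expi (x * t)).
  by apply: eq_Rintegral => t _; rewrite conjc1 mulr1.
by apply: mean_cvg; case: (cbcont_expi x).
Qed.

Lemma Im_transform_cvg x :
  complex.Im (transform 0 m x) @[m --> \oo] --> complex.Im (fourier x).
Proof.
under eq_fun do rewrite /transform Im_mean.
have -> : complex.Im (fourier x) = \int[mu]_t complex.Im (expi (x * t)).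
  by apply: eq_Rintegral => t _; rewrite conjc1 mulr1.
by apply: mean_cvg; case: (cbcont_expi x).
Qed.

Lemma nsq_transform_cvg x :
  nsq (transform 0 m x) @[m --> \oo] --> nsq (fourier x).
Proof.
rewrite /nsq !expr2; under eq_fun do rewrite /nsq !expr2.
have hr := Re_transform_cvg (x := x); have hi := Im_transform_cvg (x := x).
exact: (cvgD (cvgM hr hr) (cvgM hi hi)).
Qed.

(** The form of [transform_lower] that passes to limits of squared moduli. *)
Lemma nsq_transform_lower K d (x : R) :
  \sum_(i < d) ((M (K + i).+1)%:R)^-1 <= 1 / 50 :> R ->
  `|x| <= 11 / 20 * (scale N K)%:R ->
  1 / 400 <= nsq (transform K d x).
Proof.
move=> h1 h2; have := transform_lower n HNM h1 h2.
rewrite nsq_normc => h; have := normc_ge0 (transform K d x); nra.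
Qed.

(** Far enough down, the tail transforms stay bounded away from zero, so a zero
    of the limit is a zero of one of the factors. *)
Lemma fourier_eq0 x : fourier x = 0 -> exists2 k, (0 < k)%N & zero_at N M k x.
Proof.
move=> fx0.
have [K1 HK1] := small_tails (ltac:(by []) : 0 < 1 / 50 :> R) Hsum.
have [K2 HK2] := scale_large HNM (20 / 11 * `|x|).
pose K := maxn K1 K2.
have tail d : 1 / 400 <= nsq (transform K d x).
  apply: nsq_transform_lower; first by apply: HK1; rewrite leq_maxl.
  by have := HK2 K (leq_maxr _ _); lra.
have T0 : transform 0 K x = 0.
  apply/eqP; rewrite -nsq_eq0; apply/eqP/le_anti/andP; split; last exact: nsq_ge0.
  have cv : nsq (transform 0 m x) @[m --> \oo] --> (0 : R).
    by have := nsq_transform_cvg (x := x); rewrite fx0 nsq0.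
  suff : nsq (transform 0 K x) * (1 / 400) <= 0 by lra.
  apply: (cvgr_to_ge cv); exists K => // m /= Km.
  have -> : transform 0 m x = transform 0 K x * transform K (m - K) x.
    by rewrite -transform_add ?subnKC.
  by rewrite nsqM ler_wpM2l ?nsq_ge0.
have /(transform_eq0P _ HNM Hodd)[k /andP[k0 _] zk] := T0.
by exists k.
Qed.

End fourier.

(** * Colouring the line by the zero sets *)

Section colouring.
Context {R : realType}.
Implicit Types (Z : R -> Prop) (x y u v : R).

(** On the frequencies of one colour, all differences avoid [Z]; if they lie in a union
    of zero sets, they lie in the remaining ones. *)
Definition colourable (c : nat) Z : Prop :=
  exists col : R -> nat, (forall x, (col x < c)%N) /\
    forall x y, col x = col y -> ~ Z (x - y).

Definition residue (d : nat) (u : R) : nat := `|(Num.floor u %% d%:Z)%Z|%N.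

Lemma residue_lt d u : (0 < d)%N -> (residue d u < d)%N.
Proof. by move=> d0; rewrite -ltz_nat gez0_abs ?modz_ge0 ?ltz_pmod//; lia. Qed.

(** Floors turn a real lattice difference into an integer one, so that [residue]
    separates the classes of a lattice that are distinct modulo [d]. *)
Lemma residueP d u v (w : int) : (0 < d)%N -> u - v = w%:~R ->
  exists q : int, w = q * d%:Z + (residue d u)%:Z - (residue d v)%:Z.
Proof.
move=> d0 uv; have uE : u = v + w%:~R by rewrite -uv addrC subrK.
have fuv : Num.floor u = Num.floor v + w.
  by rewrite uE floorDrz ?intr_int// intrKfloor.
exists ((Num.floor u %/ d%:Z)%Z - (Num.floor v %/ d%:Z)%Z).
have eu := divz_eq (Num.floor u) d%:Z; have ev := divz_eq (Num.floor v) d%:Z.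
rewrite /residue !gez0_abs ?modz_ge0; [|lia..].
by move: fuv; rewrite {1}eu {1}ev; lia.
Qed.

Lemma colourable_sub c Z1 Z2 : (forall x, Z2 x -> Z1 x) ->
  colourable c Z1 -> colourable c Z2.
Proof.
move=> Z21 [col [colc colZ]]; exists col; split => // x y xy z.
exact: colZ xy (Z21 _ z).
Qed.

Lemma colourable_prod c1 c2 Z1 Z2 : colourable c1 Z1 -> colourable c2 Z2 ->
  colourable (c1 * c2) (fun x => Z1 x \/ Z2 x).
Proof.
move=> [col1 [c1P Z1P]] [col2 [c2P Z2P]].
exists (fun x => col1 x + c1 * col2 x)%N; split.
  by move=> x; have := c1P x; have := c2P x; nia.
move=> x y xy.
have c10 : (0 < c1)%N by exact: leq_ltn_trans (c1P x).
have e1 : col1 x = col1 y.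
  have := congr1 (fun k => k %% c1)%N xy.
  by rewrite ![(c1 * _)%N]mulnC !(addnC (col1 _)) !modnMDl !modn_small.
have e2 : col2 x = col2 y.
  by move: xy; rewrite e1 => /addnI/eqP; rewrite eqn_pmul2l// => /eqP.
by case; [exact: Z1P|exact: Z2P].
Qed.

Variables (N M : nat -> nat).
Hypothesis HNM : forall k, (1 <= k)%N -> (3 <= M k <= N k)%N.
Local Notation scale := (scale N).
Local Notation zero_at := (@zero_at R N M).

Lemma colourable_level k : colourable (M k.+1) (zero_at k.+1).
Proof.
have P0 := scaleR_gt0 (R := R) HNM k.+1.
have M0 := M_gt0 HNM k; have MR : (M k.+1)%:R != 0 :> R by rewrite pnatr_eq0; lia.
exists (fun x => residue (M k.+1) ((M k.+1)%:R * (x / (scale k.+1)%:R))); split.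
  by move=> x; exact: residue_lt.
move=> x y xy [/intrP[w wE] /negP]; apply.
have uv : (M k.+1)%:R * (x / (scale k.+1)%:R) - (M k.+1)%:R * (y / (scale k.+1)%:R) = w%:~R.
  by rewrite -wE mulrBl mulrBr.
have [q] := residueP M0 uv; rewrite xy addrK => wq; apply/intrP; exists q; apply: (mulfI MR).
by rewrite wE wq intrM -pmulrn mulrC.
Qed.

(** Let [M (k + 2) = q g] and [N (k + 2) = p g] with coprime [p] and [q], and write
    [M'] and [P] for the number of digits and the scale at level [k + 1].  Both zero
    sets lie in the lattice of step [P / (M' q)].  Colouring [x] by its class at this
    step modulo [P], refined modulo [g] by its position at step [P p], is proper and
    uses [M' q g = M' M (k + 2)] colours.  Since [q] and [M'] exceed 1, neither zero
    set contains an element congruent to plus or minus one step modulo [P]: the two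
    colours 0 and 1 can be merged, which is the purpose of the predecessor. *)
Lemma colourable_pair k : ~~ (M k.+2 %| N k.+2)%N ->
  colourable (M k.+1 * M k.+2).-1 (fun x => zero_at k.+1 x \/ zero_at k.+2 x).
Proof.
move=> ndvd.
set M1 := M k.+1; set g := gcdn (M k.+2) (N k.+2).
have M1_ge3 : (3 <= M1)%N by exact: M_ge3 HNM k.
have M2_ge3 := M_ge3 HNM k.+1; have N2_ge3 := N_ge3 HNM k.+1.
have g0 : (0 < g)%N by rewrite gcdn_gt0; lia.
pose q := (M k.+2 %/ g)%N; pose p := (N k.+2 %/ g)%N.
have Mq : M k.+2 = (q * g)%N by rewrite divnK// dvdn_gcdl.
have Np : N k.+2 = (p * g)%N by rewrite divnK// dvdn_gcdr.
have q0 : (0 < q)%N by lia.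
have p0 : (0 < p)%N by lia.
have copq : coprime q p.
  have /eqP : (gcdn (q * g) (p * g) = 1 * g)%N by rewrite -Mq -Np mul1n.
  by rewrite -muln_gcdl eqn_pmul2r.
have q1 : (1 < q)%N.
  rewrite ltn_neqAle q0 andbT; apply: contra ndvd => /eqP q1.
  by rewrite Mq Np -q1 mul1n dvdn_mull.
set P : R := (scale k.+1)%:R.
have P0 : P != 0 by rewrite gt_eqF// (scaleR_gt0 HNM).
have sE : (scale k.+2)%:R = P * (p%:R * g%:R) :> R.
  by rewrite scaleS Np !natrM.
have [gR qR pR M1R] : [/\ g%:R != 0 :> R, q%:R != 0 :> R, p%:R != 0 :> R & M1%:R != 0 :> R].
  by split; rewrite pnatr_eq0; lia.
pose l := (M1 * q)%N.
have l0 : (0 < l)%N by rewrite muln_gt0 q0 andbT; lia.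
pose u x := l%:R * (x / P); pose v x := x / (P * p%:R).
pose code x := (residue l (u x) + l * residue g (v x))%N.
have code_lt x : (code x < l * g)%N.
  have := residue_lt (u x) l0; have := residue_lt (v x) g0; rewrite /code; nia.
exists (fun x => (code x).-1); split.
  by move=> x; have := code_lt x; rewrite Mq mulnA -/l; lia.
move=> x y xy Zxy.
have lattice (w : int) : u x - u y = w%:~R ->
    (exists2 q' : int, w = q' * l%:Z & residue g (v x) = residue g (v y)) \/
    (exists q' : int, w = q' * l%:Z + 1 \/ w = q' * l%:Z - 1).
  move=> /(residueP l0)[q' wE].
  have rx := residue_lt (u x) l0; have ry := residue_lt (u y) l0.
  have [cxy|cxy] := eqVneq (code x) (code y).
    left; have ru : residue l (u x) = residue l (u y).
      have := congr1 (fun m => m %% l)%N cxy; rewrite /code.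
      by rewrite ![(l * _)%N]mulnC !(addnC (residue l _)) !modnMDl !modn_small.
    exists q'; first by rewrite wE ru addrK.
    by move: cxy; rewrite /code ru => /addnI/eqP; rewrite eqn_pmul2l// => /eqP.
  right; exists q'.
  have res_code z : (code z < l)%N -> residue l (u z) = code z.
    rewrite /code; case: (residue g (v z)) => [|b]; first by rewrite muln0 addn0.
    by rewrite mulnS; lia.
  have l6 : (6 <= l)%N by exact: (leq_mul M1_ge3 q1).
  have [[cx cy]|[cx cy]] : code x = 0%N /\ code y = 1%N \/ code x = 1%N /\ code y = 0%N by lia.
    have [ex ey] : residue l (u x) = 0%N /\ residue l (u y) = 1%N.
      by rewrite !res_code ?cx ?cy//; lia.
    by right; rewrite wE ex ey addr0.
  have [ex ey] : residue l (u x) = 1%N /\ residue l (u y) = 0%N.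
    by rewrite !res_code ?cx ?cy//; lia.
  by left; rewrite wE ex ey subr0.
case: Zxy => - [/intrP[i iE] /negP]; apply.
  have wE : u x - u y = (q%:Z * i)%:~R.
    by rewrite intrM -iE -pmulrn /u /l natrM /M1 -/P; ring.
  case: (lattice _ wE) => [[q' qE _]|[q' qE]].
    apply/intrP; exists q'; apply: (mulfI M1R).
    have -> : M1%:R * q'%:~R = (M1%:Z * q')%:~R :> R by rewrite intrM -pmulrn.
    rewrite iE; congr _%:~R; have qZ : q%:Z != 0 by lia.
    by apply: (mulfI qZ); rewrite qE /l PoszM; ring.
  exfalso; have : (q%:Z %| 1)%Z.
    case: qE => qE.
      by apply/dvdzP; exists (i - q' * M1%:Z); move: qE; rewrite /l PoszM; lia.
    by apply/dvdzP; exists (q' * M1%:Z - i); move: qE; rewrite /l PoszM; lia.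
  by rewrite dvdz1; lia.
have dE : (x - y) / P = i%:~R * p%:R / q%:R.
  have <- : (M k.+2)%:R * ((x - y) / (scale k.+2)%:R) * (p%:R / q%:R) = i%:~R * p%:R / q%:R.
    by rewrite iE mulrA.
  rewrite sE Mq natrM; field.
  by rewrite P0 gR qR pR.
have wE : u x - u y = (M1%:Z * p%:Z * i)%:~R.
  rewrite !intrM -!pmulrn /u /l natrM -mulrBr -mulrBl dE; field; by rewrite qR.
case: (lattice _ wE) => [[q' qE rv]|[q' qE]]; last first.
  exfalso; have : (M1%:Z %| 1)%Z.
    case: qE => qE.
      by apply/dvdzP; exists (p%:Z * i - q' * q%:Z); move: qE; rewrite /l PoszM; lia.
    by apply/dvdzP; exists (q' * q%:Z - p%:Z * i); move: qE; rewrite /l PoszM; lia.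
  by rewrite dvdz1; lia.
have /dvdzP[i' iE'] : (q%:Z %| i)%Z.
  have : (q%:Z %| p%:Z * i)%Z.
    have M1Z : M1%:Z != 0 by lia.
    by apply/dvdzP; exists q'; apply: (mulfI M1Z); rewrite mulrA qE /l PoszM; ring.
  by rewrite Gauss_dvdzr.
have vE : v x - v y = i'%:~R.
  rewrite /v -mulrBl invfM mulrA dE iE' intrM -pmulrn; field; by rewrite qR pR.
have [j jE] := residueP g0 vE; rewrite rv addrK in jE.
apply/intrP; exists j.
apply: (mulfI (x := (M k.+2)%:R)); first by rewrite pnatr_eq0; lia.
by rewrite iE iE' jE Mq !intrM natrM -!pmulrn; ring.
Qed.

Lemma colourable_levels K :
  colourable (\prod_(i < K) M i.+1) (fun x => exists2 j, (0 < j <= K)%N & zero_at j x).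
Proof.
elim: K => [|K IH].
  rewrite big_ord0; exists (fun=> 0%N); split => // x y _ [j].
  lia.
rewrite big_ord_recr/=; apply: colourable_sub (colourable_prod IH (colourable_level K)).
move=> x [j jK zj]; have [jK'|jK'] := leqP j K.
  by left; exists j => //; lia.
by right; rewrite (_ : K.+1 = j)//; lia.
Qed.

(** The colours of the levels multiply, so the colour saved at one pair of levels saves
    the same proportion over all of them. *)
Lemma colourable_bad_level k K : ~~ (M k.+2 %| N k.+2)%N -> (k.+2 <= K)%N ->
  exists2 c, (c * (M k.+1 * M k.+2) = (M k.+1 * M k.+2).-1 * \prod_(i < K) M i.+1)%N &
  colourable c (fun x => exists2 j, (0 < j <= K)%N & zero_at j x).
Proof.
move=> ndvd /subnK <-; elim: (K - k.+2)%N => [|d [c cE IH]].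
  rewrite add0n; exists (\prod_(i < k) M i.+1 * (M k.+1 * M k.+2).-1)%N.
    by rewrite !big_ord_recr/=; lia.
  apply: colourable_sub (colourable_prod (colourable_levels k) (colourable_pair ndvd)).
  move=> x [j jK zj]; have [jK'|jK'] := leqP j k.
    by left; exists j => //; lia.
  right; have [jk|jk] := eqVneq j k.+1; first by left; rewrite -jk.
  by right; rewrite (_ : k.+2 = j)//; lia.
rewrite addSn; exists (c * M (d + k.+2).+1)%N.
  by rewrite big_ord_recr/= mulnAC cE mulnA.
apply: colourable_sub (colourable_prod IH (colourable_level (d + k.+2))).
move=> x [j jK zj]; have [jK'|jK'] := leqP j (d + k.+2).
  by left; exists j => //; lia.
by right; rewrite (_ : (d + k.+2).+1 = j)//; lia.
Qed.

End colouring.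

(** * Geometry of the points of finite convolutions *)

Lemma seq_argmax (T : eqType) d (O : orderType d) (F : T -> O) (s : seq T) :
  s != [::] -> exists2 x, x \in s & forall y, y \in s -> (F y <= F x)%O.
Proof.
elim: s => // a s IH _; case: (altP (s =P [::])) => [->|s0].
  by exists a; rewrite ?mem_head// => y; rewrite inE => /eqP->.
have [x xs xmax] := IH s0; have [ax|xa] := leP (F a) (F x).
  exists x; first by rewrite inE xs orbT.
  by move=> y; rewrite inE => /orP[/eqP->|/xmax].
exists a; first exact: mem_head.
move=> y; rewrite inE => /orP[/eqP->//|/xmax yx].
exact: le_trans yx (ltW xa).
Qed.

Lemma count_mem_sum (T : eqType) (s : seq T) y :
  count_mem y s = (\sum_(x <- s) (x == y))%N.
Proof. by rewrite -sum1_count big_mkcond; apply: eq_bigr => x _ /=; case: (x == y). Qed.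

Section points_geometry.
Context {R : realType}.
Variables (N M n : nat -> nat).
Hypothesis HNM : forall k, (1 <= k)%N -> (3 <= M k <= N k)%N.
Local Notation points := (@points R N M n).
Local Notation scale := (scale N).
Local Notation level := (@level R N M n).

Lemma points_lattice K x : x \in points 0 K -> x * (scale K)%:R \is a Num.int.
Proof.
elim: K x => [|K IH] x /=; first by rewrite inE => /eqP ->; rewrite mul0r.
move=> /allpairsP[[t a] /= [/IH tK]] /mapP[b _ ->] ->.
rewrite mulrDl; apply: rpredD.
  by rewrite scaleS natrM mulrA rpredM// natr_int.
by rewrite add0n mulrAC mulVf ?mul1r ?intr_int// gt_eqF// (scaleR_gt0 HNM).
Qed.

Lemma level_uniq k : uniq (level k.+1).
Proof.
rewrite map_inj_uniq ?digit_seq_uniq ?(M_gt0 HNM)// => a b /(mulfI _).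
rewrite invr_eq0 gt_eqF ?(scaleR_gt0 HNM)// => /(_ isT)/eqP.
by rewrite eqr_int => /eqP.
Qed.

(** The largest point is reached by the maximal digits only. *)
Lemma points_simple K : exists2 y, y \in points 0 K & count_mem y (points 0 K) = 1%N.
Proof.
suff [y [yK _ yc]] : exists y, [/\ y \in points 0 K,
    (forall x, x \in points 0 K -> x <= y) & count_mem y (points 0 K) = 1%N].
  by exists y.
elim: K => [|K [y [yK ymax yc]]].
  by exists 0; split; rewrite ?inE//= ?eqxx// => x; rewrite inE => /eqP->.
have lv0 : level K.+1 != [::].
  by rewrite -size_eq0 (size_level _ HNM) gtn_eqF// (M_gt0 HNM).
have [a aK amax] := seq_argmax (fun x : R => x) lv0.
exists (y + a); split.
- by rewrite /= add0n; apply: allpairs_f.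
- move=> x /=; rewrite add0n => /allpairsP[[t b] /= [tK bK ->]].
  by apply: lerD; [exact: ymax|exact: amax].
- rewrite count_mem_sum /= add0n big_allpairs_dep.
  transitivity (\sum_(t <- points 0 K) \sum_(b <- level K.+1) (t == y) * (b == a))%N.
    apply: eq_big_seq => t tK; apply: eq_big_seq => b bK.
    have ty := ymax _ tK; have ba := amax _ bK.
    case: (eqVneq t y) => [->|ne]; first by rewrite (inj_eq (addrI y)) mul1n.
    have tly : t < y by rewrite lt_neqAle ne ty.
    by have := ltr_leD tly ba; case: eqP => // ->; rewrite ltxx.
  transitivity (count_mem y (points 0 K) * count_mem a (level K.+1))%N; last first.
    by rewrite yc count_uniq_mem ?level_uniq ?aK.
  rewrite !count_mem_sum big_distrl; apply: eq_bigr => t _.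
  by rewrite big_distrr.
Qed.

(** The digits [0, ..., M - 2], the irregular one being left out. *)
Definition regular_level k : seq R :=
  [seq (scale k)%:R^-1 * b%:R | b <- iota 0 (M k).-1].

Fixpoint regular_points K d : seq R :=
  if d is d'.+1 then [seq x + a | x <- regular_points K d', a <- regular_level (K + d)]
  else [:: 0].

Lemma size_regular_points K d :
  size (regular_points K d) = (\prod_(i < d) (M (K + i).+1).-1)%N.
Proof.
by elim: d => [|d IH]; rewrite ?big_ord0// big_ord_recr/= size_allpairs IH addnS
  size_map size_iota.
Qed.

Lemma sum_regular_le K d (f : R -> R) : (forall x, 0 <= f x) ->
  \sum_(x <- regular_points K d) f x <= \sum_(x <- points K d) f x.
Proof.
elim: d f => [|d IH] f f0 //=; rewrite !big_allpairs_dep/=.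
have lev x : \sum_(a <- regular_level (K + d.+1)) f (x + a) <=
             \sum_(a <- level (K + d.+1)) f (x + a).
  rewrite !big_map /digit_seq -cats1 big_cat /= big_map big_seq1.
  rewrite lerDl//.
apply: le_trans (IH _ _).
  by apply: ler_sum => x _; exact: lev.
by move=> x; apply: sumr_ge0.
Qed.

(** The induction carries the room for one more step of the finest scale, which the
    regular digits of the next level cannot exhaust, as [M - 1 <= N]. *)
Lemma regular_points_bound K d x : x \in regular_points K d ->
  0 <= x * (scale K)%:R <= 1 - (M K.+1)%:R^-1.
Proof.
have PK := scaleR_gt0 (R := R) HNM K.
have MK : 1 <= (M K.+1)%:R :> R by rewrite ler1n (M_gt0 HNM).
case: d => [|d].
  by rewrite inE => /eqP ->; rewrite mul0r lexx subr_ge0 invf_le1// (lt_le_trans _ MK).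
suff : x \in regular_points K d.+1 ->
    0 <= x /\ (x + (scale (K + d).+1)%:R^-1) * (scale K)%:R <= 1 - (M K.+1)%:R^-1.
  move=> h /h[x0 xb]; rewrite mulr_ge0 ?(ltW PK)//=; apply: le_trans xb.
  by rewrite ler_pM2r// lerDl invr_ge0.
elim: d x => [|d IH] x.
  move=> /allpairsP[[t a] /= []]; rewrite inE => /eqP-> /mapP[b].
  rewrite mem_iota add0n addn1 => /andP[_ bM] -> ->.
  rewrite add0r addn0; split; first by rewrite mulr_ge0 ?invr_ge0.
  have N0 : 0 < (N K.+1)%:R :> R by rewrite ltr0n (leq_trans _ (N_ge3 HNM K)).
  have -> : ((scale K.+1)%:R^-1 * b%:R + (scale K.+1)%:R^-1) * (scale K)%:R =
      (b.+1)%:R / (N K.+1)%:R :> R.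
    by rewrite scaleS natrM -natr1; field; rewrite !gt_eqF.
  have -> : 1 - (M K.+1)%:R^-1 = (M K.+1).-1%:R / (M K.+1)%:R :> R.
    rewrite -subn1 natrB ?(M_gt0 HNM)//; field; rewrite gt_eqF//; lra.
  rewrite ler_pM ?invr_ge0 ?ler_nat//.
  by rewrite lef_pV2 ?posrE ?ltr0n ?(M_gt0 HNM) ?ler_nat ?(M_leN HNM)// (leq_trans _ (N_ge3 HNM K)).
move=> /allpairsP[[t a] /= [/IH[t0 tb]]] /mapP[b].
rewrite mem_iota add0n addnS => /andP[_ bM] -> ->.
split; first by rewrite addr_ge0// mulr_ge0 ?invr_ge0.
apply: le_trans tb; rewrite ler_pM2r// -addrA lerD2l addnS.
set k := (K + d).+1 in bM *.
have N0 : 0 < (N k.+1)%:R :> R by rewrite ltr0n (leq_trans _ (N_ge3 HNM k)).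
have Pk := scaleR_gt0 (R := R) HNM k.
rewrite -[X in _ + X]mulr1 -mulrDr natr1 scaleS natrM invfM -mulrA ler_piMr ?invr_ge0//.
rewrite mulrC ler_pdivrMr// mul1r ler_nat (leq_trans _ (M_leN HNM k))//.
by rewrite (leq_trans bM)// addnS; exact: leq_pred.
Qed.

(** Among the digit strings of the levels after [K], the regular ones form the
    proportion [\prod (1 - 1 / M_j)], and [f] is 1 at their sums. *)
Lemma regular_mass K d (f : R -> R) : (forall x, 0 <= f x) ->
  (forall x, 0 <= x * (scale K)%:R <= 1 - (M K.+1)%:R^-1 -> f x = 1) ->
  1 - \sum_(i < d) ((M (K + i).+1)%:R)^-1 <= mean (points K d) f.
Proof.
move=> f0 f1.
have Mi i : 0 < (M (K + i).+1)%:R :> R by rewrite ltr0n (M_gt0 HNM).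
apply: (@le_trans _ _ (\prod_(i < d) (1 - ((M (K + i).+1)%:R)^-1))).
  apply: (@prod_ge_1Bsum R d (fun i => 1 - ((M (K + i).+1)%:R)^-1)
    (fun i => ((M (K + i).+1)%:R)^-1)) => // i.
  by rewrite subr_ge0 invf_le1// ler1n (M_gt0 HNM).
rewrite /mean; apply: le_trans (ler_wpM2r _ (sum_regular_le _ _ f0)); last by rewrite invr_ge0.
have -> : \sum_(x <- regular_points K d) f x = (size (regular_points K d))%:R.
  rewrite (eq_big_seq (fun=> 1)); last first.
    by move=> x xr; apply: f1; exact: regular_points_bound xr.
  by rewrite big_const_seq count_predT iter_addr addr0.
rewrite size_regular_points.
rewrite (size_points _ HNM) !natr_prod -prodf_div.
rewrite le_eqVlt; apply/orP; left; apply/eqP; apply: eq_bigr => i _.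
rewrite addnS -subn1 natrB ?(M_gt0 HNM)//; field.
by rewrite gt_eqF.
Qed.

(** A plateau on the cell that contains the regular tails, narrow enough for its
    translates by the lattice of step [1 / scale K] to be disjoint. *)
Lemma bump_exists K : exists phi : R -> R, [/\ bcont phi,
  (forall t, 0 <= phi t <= 1),
  (forall t, 0 <= t * (scale K)%:R <= 1 - (M K.+1)%:R^-1 -> phi t = 1) &
  (forall t u, phi t != 0 -> phi u != 0 ->
    (t - u) * (scale K)%:R \is a Num.int -> t = u)].
Proof.
have PK := scaleR_gt0 (R := R) HNM K.
pose delta : R := (M K.+1)%:R^-1.
have delta0 : 0 < delta by rewrite invr_gt0 ltr0n (M_gt0 HNM).
have delta1 : delta < 1.
  by rewrite invf_lt1 ?ltr0n ?(M_gt0 HNM)// ltr1n (leq_trans _ (M_ge3 HNM K)).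
pose u t : R := t * (scale K)%:R.
pose dist t : R := Num.max 0 (Num.max (- u t) (u t - (1 - delta))).
pose phi t : R := Num.max 0 (1 - 4 / delta * dist t).
have dist0 t : 0 <= dist t by rewrite le_max lexx.
exists phi; split.
- split; last first.
    exists 1 => t; rewrite ger0_norm ?le_max ?lexx// ge_max ler01 /=.
    by rewrite lerBlDr lerDl mulr_ge0// divr_ge0// ltW.
  have cu : continuous u by move=> t; apply: cvgMl; exact: cvg_id.
  have cmax (f g : R -> R) : continuous f -> continuous g ->
      continuous (fun t => Num.max (f t) (g t)).
    by move=> cf cg t; apply: continuous_max; [exact: cf|exact: cg].
  have cd : continuous dist.
    apply: (cmax (fun=> 0)); first exact: cst_continuous.
    apply: cmax => t; first by apply: cvgN; exact: cu.
    by apply: cvgB; [exact: cu|exact: cvg_cst].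
  apply: (cmax (fun=> 0)); first exact: cst_continuous.
  by move=> t; apply: cvgB; [exact: cvg_cst|apply: cvgMr; exact: cd].
- move=> t; rewrite le_max lexx ge_max ler01 /=.
  by rewrite lerBlDr lerDl mulr_ge0// divr_ge0// ltW.
- move=> t /andP[t0 t1]; rewrite /phi /dist.
  have -> : Num.max (0 : R) (Num.max (- u t) (u t - (1 - delta))) = 0.
    by apply/max_idPl; rewrite ge_max /u; apply/andP; split; rewrite /delta; lra.
  by rewrite mulr0 subr0; apply/max_idPr.
- have supp t : phi t != 0 -> - (delta / 4) < u t < 1 - delta + delta / 4.
    move=> ft; have fd : 4 / delta * dist t < 1.
      rewrite ltNge; apply: contra ft => h; apply/eqP/max_idPl.
      by rewrite subr_le0.
    have dd : dist t < delta / 4.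
      by rewrite ltr_pdivlMr// mulrC; rewrite mulrAC ltr_pdivrMr// mul1r in fd.
    move: dd; rewrite /dist !gt_max => /andP[_ /andP[d1 d2]].
    by apply/andP; split; lra.
  move=> t v /supp/andP[t1 t2] /supp/andP[v1 v2] /intrP[m mE].
  have mB : `|m%:~R| < 1 :> R.
    by rewrite -mE mulrBl -/(u t) -/(u v) ltr_norml; apply/andP; split; lra.
  have m0 : m = 0 by move: mB; rewrite -intr_norm ltrz1; lia.
  by move/eqP: mE; rewrite m0 mulf_eq0 (gt_eqF PK) orbF subr_eq0 => /eqP.
Qed.

(** Distinct points are at distance at least one cell: at most one of them
    contributes, with its multiplicity. *)
Lemma sum_bump_points K (phi : R -> R) (C : nat) (y : R) t :
  (forall t, 0 <= phi t <= 1) ->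
  (forall t u, phi t != 0 -> phi u != 0 ->
    (t - u) * (scale K)%:R \is a Num.int -> t = u) ->
  y \in points 0 K -> count_mem y (points 0 K) = 1%N ->
  (forall x, x \in points 0 K -> (count_mem x (points 0 K) <= C)%N) ->
  \sum_(x <- points 0 K) phi (x + t - y) ^+ 2 <= phi t ^+ 2 + C%:R * (1 - phi t ^+ 2).
Proof.
move=> phi01 sep yK yc cC.
have phi2 u : 0 <= phi u ^+ 2 <= 1.
  by have /andP[h0 h1] := phi01 u; rewrite sqr_ge0/= exprn_ile1.
have one x1 : x1 \in points 0 K -> phi (x1 + t - y) != 0 ->
    \sum_(x <- points 0 K) phi (x + t - y) ^+ 2 =
    (count_mem x1 (points 0 K))%:R * phi (x1 + t - y) ^+ 2.
  move=> x1K p1; rewrite count_mem_sum natr_sum mulr_suml; apply: eq_big_seq => x xK.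
  case: eqVneq => [->|xx1]; first by rewrite mul1r.
  rewrite mul0r; apply/eqP; rewrite sqrf_eq0; apply: contraT => px.
  have /addIr/addIr : x + t - y = x1 + t - y.
    apply: sep => //.
    have -> : (x + t - y - (x1 + t - y)) * (scale K)%:R =
        x * (scale K)%:R - x1 * (scale K)%:R by ring.
    by apply: rpredB; exact: points_lattice.
  by move/eqP; rewrite (negbTE xx1).
have [pt0|pt0] := eqVneq (phi t) 0; last first.
  rewrite (one y) ?yc ?mul1r; rewrite // (addrC y) addrK//.
  by rewrite lerDl mulr_ge0// subr_ge0; case/andP: (phi2 t).
have [/hasP[x1 x1K p1]|/hasPn p0] := boolP (has (fun x => phi (x + t - y) != 0) (points 0 K)).
  rewrite (one x1)// pt0 expr0n subr0 add0r mulr1.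
  have /andP[h0 h1] := phi2 (x1 + t - y).
  by rewrite -[leRHS]mulr1 ler_pM// ler_nat cC.
rewrite big1_seq; first by rewrite pt0 expr0n subr0 add0r mulr1.
by move=> x /andP[_ /p0]; rewrite negbK => /eqP ->; rewrite expr0n.
Qed.

End points_geometry.

(** * Bessel bounds at a finite level *)

(** Here [tau] is the squared norm of the bump in the tail, [Q] the square sum of its
    coefficients, [Mt] the number of points with multiplicity, [C] the greatest
    multiplicity, and [1 - 1 / W] the proportion of colours kept.  The first upper
    bound for [Q] excludes [C >= 2], where it is too small by a factor of about [C];
    the second one excludes [C = 1], where it is too small by the factor [1 - 1 / W]. *)
Lemma mass_contradiction (R : realType) (tau Q S A G eps W Mt : R) (C : nat) :
  0 < eps -> 10 * eps * W = 1 -> 9 <= W -> 1 - eps <= tau <= 1 -> (1 <= C)%N ->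
  0 <= Q -> 1 <= Mt -> 0 <= S -> 
  Q * C%:R <= tau * Mt -> Q * W <= (W - 1) * Mt * tau ->
  A * Mt <= tau + C%:R * (1 - tau) ->
  S <= (1 + eps) * A + (1 + eps^-1) * G ->
  G * Mt ^+ 2 <= eps ^+ 2 ->
  (tau - eps) ^+ 2 <= Q * S -> False.
Proof.
move=> e0 eW W9 /andP[t0 t1] C1 Q0 Mt1 S0 QC QW AM SA GM tQ.
have e90 : eps <= 90^-1.
  rewrite -(ler_pM2r (_ : 0 < 10 * W)); last by lra.
  by rewrite (_ : eps * (10 * W) = 1); lra.
set X := (1 + eps) * (tau + C%:R * (1 - tau)) + 2 * eps.
have SX : S * Mt <= X.
  have GM1 : G * Mt <= eps ^+ 2.
    have [G0|G0] := leP 0 G; first by apply: le_trans GM; rewrite expr2 mulrA ler_peMr// mulr_ge0//; lra.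
    apply: (@le_trans _ _ 0); last exact: sqr_ge0.
    by apply: mulr_le0_ge0; lra.
  have eG : (1 + eps^-1) * (G * Mt) <= eps ^+ 2 + eps.
    apply: (@le_trans _ _ ((1 + eps^-1) * eps ^+ 2)).
      by rewrite ler_wpM2l// addr_ge0// invr_ge0 ltW.
    by rewrite mulrDl mul1r expr2 mulKf ?gt_eqF.
  have h : S * Mt <= (1 + eps) * (A * Mt) + (1 + eps^-1) * (G * Mt).
    have : S * Mt <= ((1 + eps) * A + (1 + eps^-1) * G) * Mt by rewrite ler_pM2r//; lra.
    by rewrite mulrDl -!mulrA.
  have h2 : (1 + eps) * (A * Mt) <= (1 + eps) * (tau + C%:R * (1 - tau)).
    by rewrite ler_pM2l//; lra.
  rewrite /X; nra.
have X0 : 0 <= X by apply: le_trans SX; rewrite mulr_ge0//; lra.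
have tX : (tau - eps) ^+ 2 * Mt <= Q * X.
  apply: (@le_trans _ _ (Q * S * Mt)); first by rewrite ler_pM2r//; lra.
  by rewrite -mulrA ler_wpM2l.
have C0 : 1 <= C%:R :> R by rewrite ler1n.
have tXC : C%:R * (tau - eps) ^+ 2 <= tau * X.
  rewrite -(ler_pM2r (_ : 0 < Mt)); last by lra.
  apply: (@le_trans _ _ (Q * C%:R * X)).
    by have := ler_wpM2l (ler0n R C) tX; lra.
  by have := ler_wpM2r X0 QC; lra.
have tXW : W * (tau - eps) ^+ 2 <= (W - 1) * tau * X.
  rewrite -(ler_pM2r (_ : 0 < Mt)); last by lra.
  apply: (@le_trans _ _ (Q * W * X)).
    by have := ler_wpM2l (_ : 0 <= W) tX; lra.
  by have := ler_wpM2r X0 QW; lra.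
have te : 1 - 4 * eps <= (tau - eps) ^+ 2 by nra.
have [C2|C2] := leqP 2 C.
  have C2R : 2 <= C%:R :> R by rewrite ler_nat.
  have XC : tau * X <= (1 + eps) * (1 + C%:R * eps) + 2 * eps.
    have h1 : X <= (1 + eps) * (1 + C%:R * eps) + 2 * eps.
      rewrite /X lerD2r ler_pM2l; last by lra.
      by apply: lerD => //; rewrite ler_wpM2l//; lra.
    apply: le_trans h1; rewrite ler_piMl//.
  have h3 : C%:R * (1 - 4 * eps) <= (1 + eps) * (1 + C%:R * eps) + 2 * eps.
    by apply: le_trans XC; apply: le_trans tXC; rewrite ler_wpM2l//; lra.
  have ce : C%:R * eps <= C%:R * 90^-1 by rewrite ler_wpM2l.
  have cee : C%:R * eps * eps <= C%:R * 90^-1.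
    by apply: le_trans ce; rewrite ler_piMr ?mulr_ge0//; lra.
  lra.
have CE : C%:R = 1 :> R.
  by have /eqP -> : C == 1%N by rewrite eqn_leq C1 -ltnS C2.
have XE : X = 1 + 3 * eps by rewrite /X CE; ring.
have h4 : W * (1 - 4 * eps) <= (W - 1) * (1 + 3 * eps).
  apply: (@le_trans _ _ (W * (tau - eps) ^+ 2)); first by rewrite ler_pM2l//; lra.
  apply: (le_trans tXW); rewrite XE -mulrA ler_pM2l; last by lra.
  by rewrite ler_piMl//; lra.
have : W * eps = 1 / 10 by lra.
lra.
Qed.

Section finite_level.
Context {R : realType}.
Variables (N M n : nat -> nat).
Hypothesis HNM : forall k, (1 <= k)%N -> (3 <= M k <= N k)%N.
Hypothesis Hodd : forall k, (1 <= k)%N -> odd (M k).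
Local Notation points := (@points R N M n).
Local Notation scale := (scale N).
Local Notation zero_at := (@zero_at R N M).
Local Notation e l := (fun t : R => expi (l * t)).

Lemma inner_expi K d (l l' : R) :
  inner (points K d) (e l) (e l') = transform N M n K d (l - l').
Proof. by apply: eq_mean => t _; rewrite -expiN -expiD mulrBl. Qed.

Lemma orthonormal_expi K d (s : seq R) :
  {in s &, forall l l', l != l' -> exists2 j, (K < j <= K + d)%N & zero_at j (l - l')} ->
  {in s &, forall l l', inner (points K d) (e l) (e l') = (l == l')%:R}.
Proof.
move=> sZ l l' ls l's; rewrite inner_expi; have [->|ll'] := eqVneq l l'.
  rewrite subrr /transform (eq_mean (g := fun=> 1)); last first.
    by move=> t _; rewrite mul0r expi0.
  by rewrite mean_cst// (points_neq_nil _ HNM).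
by apply/(transform_eq0P n HNM Hodd); exact: sZ.
Qed.

Variables (K d : nat) (phi : R -> R) (s : seq R).
Hypothesis s_uniq : uniq s.
Hypothesis s_zero : {in s &, forall l l', l != l' ->
  exists2 j, (0 < j <= K + d)%N & zero_at j (l - l')}.
Let phiC t := (phi t)%:C%C.
Let tau := mean (points K d) (fun t => phi t ^+ 2).
Let Q := \sum_(l <- s) nsq (inner (points K d) phiC (e l)).

Let tauE : mean (points K d) (fun t => nsq (phiC t)) = tau.
Proof. by apply: eq_mean => t _; rewrite nsq_real. Qed.

(** On each colour the exponentials are orthonormal for the tail alone. *)
Lemma Bessel_colours c :
  colourable c (fun x => exists2 j, (0 < j <= K)%N & zero_at j x) ->
  Q <= c%:R * tau.
Proof.
move=> [col [colc colZ]].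
rewrite /Q (partition_big (fun l => Ordinal (colc l)) xpredT)//=.
rewrite -[c in leRHS]card_ord mulr_natl -sumr_const; apply: ler_sum => i _.
rewrite -big_filter -tauE; apply: Bessel; first exact: filter_uniq.
apply: orthonormal_expi => l l'; rewrite !mem_filter.
move=> /andP[/eqP li ls] /andP[/eqP l'i l's] ll'.
have [j /andP[j0 jKd] zj] := s_zero ls l's ll'.
exists j => //; rewrite jKd andbT ltnNge; apply/negP => jK.
apply: (colZ l l'); last by exists j; rewrite ?j0.
by have := congr1 val (etrans li (esym l'i)).
Qed.

Let E := points 0 (K + d).
Let T := points K d.
Let Mt : R := (size (points 0 K))%:R.

Let Mt_gt0 : 0 < Mt.
Proof.
rewrite ltr0n lt0n size_eq0; exact: points_neq_nil HNM 0%N K.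
Qed.

Let E_orth : {in s &, forall l l', inner E (e l) (e l') = (l == l')%:R}.
Proof. by apply: orthonormal_expi => l l' ls l's ll'; rewrite add0n; exact: s_zero. Qed.

(** The translate of the tail by a point [y] is dominated by the whole, up to the
    mass of [y]. *)
Lemma count_mean_le (F : R -> R) y : (forall x, 0 <= F x) ->
  (count_mem y (points 0 K))%:R * mean T (fun t => F (y + t)) <= Mt * mean E F.
Proof.
move=> F0; rewrite /E mean_points_add [leRHS]mulrC /mean divfK ?gt_eqF//.
rewrite count_mem_sum natr_sum mulr_suml; apply: ler_sum => x _.
case: eqVneq => [->|_]; first by rewrite mul1r.
by rewrite mul0r; apply: mean_ge0.
Qed.

Let shift_inner y l :
  inner T phiC (fun t => expi (l * (y + t))) = (expi (l * y))^*%C * inner T phiC (e l).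
Proof.
rewrite /inner -meanZ; apply: eq_mean => t _.
by rewrite mulrDr expiD rmorphM/= mulrCA.
Qed.

Let inner_lincomb y (c : R -> R[i]) :
  inner T phiC (fun t => \sum_(l <- s) c l * expi (l * (y + t))) =
  \sum_(l <- s) (c l)^*%C * inner T phiC (fun t => expi (l * (y + t))).
Proof.
rewrite /inner.
under eq_mean do rewrite rmorph_sum/= mulr_sumr.
rewrite mean_sum; apply: eq_bigr => l _; rewrite -meanZ; apply: eq_mean => t _.
by rewrite rmorphM/= mulrCA.
Qed.

(** Duality: for the combination [p] of exponentials whose coefficients are those of
    the bump translated to [y], the square sum [Q] is an inner product in the tail at
    [y].  There the norm of [p] is controlled by its norm in the whole convolution,
    which is again [Q]. *)
Lemma Bessel_multiplicity y : Q * (count_mem y (points 0 K))%:R <= tau * Mt.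
Proof.
pose c l := inner T phiC (fun t => expi (l * (y + t))).
have QE : Q = \sum_(l <- s) nsq (c l).
  apply: eq_bigr => l _; rewrite /c shift_inner nsqM nsq_conj nsq_expi mul1r.
  by [].
pose p x := \sum_(l <- s) c l * expi (l * x).
have ip : inner T phiC (fun t => p (y + t)) = Q%:C%C.
  rewrite inner_lincomb QE rmorph_sum/=; apply: eq_bigr => l _.
  by rewrite -/(c l) nsqE mulrC.
have := Cauchy_Schwarz_mean T phiC (fun t => p (y + t)).
rewrite ip nsq_real tauE => QQ.
have := count_mean_le y (F := fun x => nsq (p x)) (fun x => nsq_ge0 _).
rewrite (mean_nsq_lincomb s_uniq E_orth) -QE => CQ.
have tau0 : 0 <= tau by apply: mean_ge0 => t; exact: sqr_ge0.
have [Q0|Q0] := leP Q 0.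
  apply: (@le_trans _ _ 0); last by rewrite mulr_ge0// ltW.
  by rewrite mulr_le0_ge0.
have h1 := ler_wpM2l tau0 CQ.
have h2 := ler_wpM2r (ler0n R (count_mem y (points 0 K))) QQ.
rewrite -(ler_pM2l Q0); lra.
Qed.

(** If [p] is close to the translate of the bump to [y], the inner product of the bump
    with [p] in the tail at [y] is close to [tau], and by Cauchy--Schwarz it is
    bounded in terms of [Q] and of the coefficients of [p].  Those are bounded by the
    norm of the translated bump in the whole convolution. *)
Lemma bump_projection_bound y (c : R -> R[i]) (eps : R) :
  0 < eps -> eps <= tau -> tau <= 1 -> (0 < count_mem y (points 0 K))%N ->
  let p x := \sum_(l <- s) c l * expi (l * x) in
  let G := mean E (fun x => nsq ((phi (x - y))%:C%C - p x)) in
  G * Mt <= eps ^+ 2 ->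
  (tau - eps) ^+ 2 <= Q * \sum_(l <- s) nsq (c l) /\
  \sum_(l <- s) nsq (c l) <=
    (1 + eps) * mean E (fun x => phi (x - y) ^+ 2) + (1 + eps^-1) * G.
Proof.
move=> e0 etau tau1 yc p G GM; split; last first.
  rewrite -(mean_nsq_lincomb s_uniq E_orth c) /G -!meanZ -meanD.
  apply: le_mean => x _.
  rewrite -/(p x) -[p x in leLHS](subKr (phi (x - y))%:C%C).
  by apply: le_trans (nsqD_weighted _ _ e0) _; rewrite nsq_real nsqN.
set z := inner T phiC (fun t => p (y + t)).
have zQ : nsq z <= Q * \sum_(l <- s) nsq (c l).
  rewrite /z inner_lincomb mulrC.
  have -> : \sum_(l <- s) nsq (c l) = \sum_(l <- s) nsq ((c l)^*)%C.
    by apply: eq_bigr => l _; rewrite nsq_conj.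
  have -> : Q = \sum_(l <- s) nsq ((inner T phiC (fun t => expi (l * (y + t))))^*)%C.
    by apply: eq_bigr => l _; rewrite nsq_conj shift_inner nsqM nsq_conj nsq_expi mul1r.
  apply: le_trans (Cauchy_Schwarz_sum _ _ _).
  by rewrite le_eqVlt; apply/orP; left; apply/eqP; congr nsq; apply: eq_bigr => l _;
    rewrite conjcK.
have tz : nsq (tau%:C%C - z) <= eps ^+ 2.
  have -> : tau%:C%C - z = inner T phiC (fun t => phiC t - p (y + t)).
    rewrite -tauE -inner_diag /z /inner -meanN -meanD; apply: eq_mean => t _.
    by rewrite rmorphB/= mulrBr.
  apply: (le_trans (Cauchy_Schwarz_mean _ _ _)); rewrite tauE.
  have h0 : 0 <= mean T (fun t => nsq (phiC t - p (y + t))).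
    by apply: mean_ge0 => t; exact: nsq_ge0.
  apply: (@le_trans _ _ (mean T (fun t => nsq (phiC t - p (y + t))))).
    by rewrite ler_piMl.
  apply: le_trans GM; rewrite [leRHS]mulrC.
  have := count_mean_le y (F := fun x => nsq ((phi (x - y))%:C%C - p x)) (fun x => nsq_ge0 _).
  apply: le_trans; rewrite (eq_mean (g := fun t => nsq (phiC t - p (y + t)))); last first.
    by move=> t _; rewrite (addrC y) addrK (addrC t).
  by rewrite ler_peMl// ler1n.
apply: le_trans zQ.
have zR : complex.Re z ^+ 2 <= nsq z by rewrite lerDl sqr_ge0.
apply: le_trans zR.
have : (tau - complex.Re z) ^+ 2 <= eps ^+ 2.
  apply: le_trans tz; rewrite [leRHS]/nsq.
  by case: (z) => a b /=; rewrite lerDl sqr_ge0.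
rewrite -ler_sqrt ?sqr_ge0// !sqrtr_sqr (ger0_norm (ltW e0)) ler_norml => /andP[h1 h2].
nra.
Qed.

End finite_level.

(** * Necessity of divisibility *)

Section necessity.
Context {R : realType} (mu : probability R R).
Variables (N M n : nat -> nat) (B : nat -> {fset int}).
Hypothesis HNM : forall k, (1 <= k)%N -> (3 <= M k <= N k)%N.
Hypothesis Hodd : forall k, (1 <= k)%N -> odd (M k).
Hypothesis HB : forall k, (1 <= k)%N -> B k = digits (M k) (n k).
Hypothesis Hmu : infinite_convolution N B mu.
Hypothesis Hsum : (\sum_(1 <= k <oo) (((M k)%:R : R)^-1)%:E < +oo)%E.
Local Notation points := (@points R N M n).
Local Notation zero_at := (@zero_at R N M).

Lemma in_L2_cbcont (f : R -> R[i]) : cbcont f -> in_L2 mu f.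
Proof.
move=> cf; split.
- by apply: continuous_measurable_fun; case: cf => - [].
- by apply: continuous_measurable_fun; case: cf => _ [].
- by apply/L2norm_ltyP; rewrite (bcont_integralE _ (cbcont_nsq cf)) ltry.
Qed.

(** Finitely many frequencies involve finitely many levels only, so they are already
    orthogonal for some finite convolution. *)
Lemma orthogonal_zero_bound (L : set R) (s : seq R) :
  (forall l l', L l -> L l' -> L2inner mu (character l) (character l') = (l == l')%:R) ->
  {subset s <= L} ->
  exists J, {in s &, forall l l', l != l' ->
    exists2 j, (0 < j <= J)%N & zero_at j (l - l')}.
Proof.
move=> orth sL.
have zero l l' : exists j, l \in s -> l' \in s -> l != l' -> (0 < j)%N /\ zero_at j (l - l').
  have [[ls [l's ll']]|no] := pselect (l \in s /\ (l' \in s /\ l != l')); last first.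
    by exists 0%N => ls l's ll'; exfalso; exact: no.
  have := orth l l' (set_mem (sL _ ls)) (set_mem (sL _ l's)).
  rewrite (negbTE ll') L2inner_expi => f0.
  by have [j j0 zj] := fourier_eq0 HNM Hodd HB Hmu Hsum f0; exists j.
have [J0 J0P] := choice (fun ll : R * R => zero ll.1 ll.2).
exists (\max_(l <- s) \max_(l' <- s) J0 (l, l')) => l l' ls l's ll'.
have [j0 zj] := J0P (l, l') ls l's ll'; exists (J0 (l, l')) => //.
rewrite j0 /=; apply: leq_trans (leq_bigmax_seq _ ls isT).
exact: (@leq_bigmax_seq _ s xpredT (fun l' => J0 (l, l')) l').
Qed.

(** A point [y] of multiplicity one receives from the other points at most the mass that
    the bump misses, with multiplicity at most [C]. *)
Lemma mean_bump_bound K d (phi : R -> R) (C : nat) y :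
  (forall t, 0 <= phi t <= 1) ->
  (forall t u, phi t != 0 -> phi u != 0 ->
    (t - u) * (scale N K)%:R \is a Num.int -> t = u) ->
  y \in points 0 K -> count_mem y (points 0 K) = 1%N ->
  (forall x, x \in points 0 K -> (count_mem x (points 0 K) <= C)%N) ->
  let tau := mean (points K d) (fun t => phi t ^+ 2) in
  mean (points 0 (K + d)) (fun x => phi (x - y) ^+ 2) * (size (points 0 K))%:R <=
  tau + C%:R * (1 - tau).
Proof.
move=> phi01 sep yK yc cC; cbv zeta; set tau := mean (points K d) _.
have S0 : (size (points 0 K))%:R != 0 :> R.
  by rewrite pnatr_eq0 size_eq0; exact: points_neq_nil HNM 0%N K.
rewrite mean_points_add {1}/mean divfK// -mean_sum.
have -> : tau + C%:R * (1 - tau) =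
    mean (points K d) (fun t => phi t ^+ 2 + C%:R * (1 - phi t ^+ 2)).
  rewrite meanD meanZ meanD mean_cst ?(points_neq_nil _ HNM)//.
  by rewrite meanN.
by apply: le_mean => t _; exact: (sum_bump_points (n := n) HNM).
Qed.

Theorem spectral_dvd : spectral_measure mu -> forall k, (2 <= k)%N -> (M k %| N k)%N.
Proof.
move=> [L [_ [_ orth basis]]] [//|[//|k]] _; apply: contraT => ndvd.
have M1 := M_ge3 HNM k; have M2 := M_ge3 HNM k.+1.
pose W : R := (M k.+1 * M k.+2)%N%:R.
have W9 : 9 <= W by rewrite ler_nat; exact: (leq_mul M1 M2).
(* small against the proportion 1 / W of the colours saved at the bad pair *)
pose eps : R := (10 * W)^-1.
have eps0 : 0 < eps by rewrite invr_gt0; lra.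
have eW : 10 * eps * W = 1 by rewrite mulrAC mulfV// gt_eqF//; lra.
have [K0 HK0] := small_tails eps0 Hsum.
pose K := maxn K0 k.+2.
have kK : (k.+2 <= K)%N by rewrite leq_maxr.
have [phi [bphi phi01 phi1 sep]] := bump_exists (R := R) HNM K.
have [y yK yc] := points_simple (R := R) n HNM K.
have [y1 y1K y1max] := seq_argmax (fun x => count_mem x (points 0 K))
  (points_neq_nil (R := R) n HNM 0 K).
set C := count_mem y1 (points 0 K).
have C1 : (1 <= C)%N by rewrite /C -has_count; apply/hasP; exists y1 => //=.
pose Mt : R := (size (points 0 K))%:R.
have Mt1 : 1 <= Mt by rewrite ler1n lt0n size_eq0; exact: points_neq_nil HNM 0%N K.
have [c cE col] := colourable_bad_level (R := R) HNM ndvd kK.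
have cW : c%:R * W = (W - 1) * Mt.
  have -> : W - 1 = (M k.+1 * M k.+2).-1%:R.
    by rewrite -subn1 natrB// muln_gt0; lia.
  rewrite /W /Mt (size_points _ HNM) -!natrM cE; congr (_ * _)%N%:R.
pose f x : R[i] := (phi (x - y))%:C%C.
have cf : cbcont f.
  apply: cbcont_real; case: bphi => cphi [D phiD]; split; last by exists D.
  move=> x; apply: continuous_comp; last exact: cphi.
  by apply: cvgB; [exact: cvg_id|exact: cvg_cst].
(* the tail at y has density at most Mt, hence this accuracy *)
have sigma0 : 0 < eps / Mt by rewrite divr_gt0//; lra.
have [s [a [sL fs]]] := basis f (in_L2_cbcont cf) _ sigma0.
pose p x := \sum_(l <- s) a l * expi (l * x).
have fp : (\int[mu]_x (nsq (f x - p x))%:E < ((eps / Mt) ^+ 2)%:E)%E.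
  apply/L2norm_ltP => //; apply: le_lt_trans fs.
  rewrite le_eqVlt; apply/orP; left; apply/eqP; congr (L2norm _ _).
  apply/funext => x; congr (_ - _); apply: eq_bigr => l _.
  by rewrite characterE.
have cfp : bcont (fun x => nsq (f x - p x)).
  apply: cbcont_nsq; apply: cbcontD => //; apply: cbcontN.
  exact: (cbcont_lincomb s a (fun l => l)).
rewrite (bcont_integralE _ cfp) lte_fin in fp.
have [J sJ] := orthogonal_zero_bound orth (fun l ls => mem_set (sL l ls)).
have [m0 _ Hm0] : \forall m \near \oo, mean (points 0 m) (fun x => nsq (f x - p x)) < (eps / Mt) ^+ 2.
  by apply: cvgr_lt fp; exact: (mean_cvg HNM HB Hmu).
(* enough levels for the frequencies in s to be orthogonal and for the distance
   from the bump to p to be nearly that of the limit *)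
pose d := maxn m0 J.
have Gd : mean (points 0 (K + d)) (fun x => nsq (f x - p x)) < (eps / Mt) ^+ 2.
  by apply: Hm0; rewrite /= (leq_trans (leq_maxl m0 J))// leq_addl.
set tau := mean (points K d) (fun t => phi t ^+ 2).
have tauP : 1 - eps <= tau <= 1.
  have phi2 t : 0 <= phi t ^+ 2 <= 1.
    by have /andP[h0 h1] := phi01 t; rewrite sqr_ge0/= exprn_ile1.
  apply/andP; split.
    apply: (@le_trans _ _ (1 - \sum_(i < d) ((M (K + i).+1)%:R)^-1)).
      by rewrite lerD2l lerN2; apply: HK0; rewrite leq_maxl.
    apply: regular_mass => //; first by move=> t; exact: sqr_ge0.
    by move=> t /phi1 ->; rewrite expr1n.
  rewrite -[leRHS](mean_cst (F := R) (s := points K d)) ?(points_neq_nil _ HNM)//.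
  by apply: le_mean => t _; case/andP: (phi2 t).
have sZ : {in s &, forall l l', l != l' -> exists2 j, (0 < j <= K + d)%N & zero_at j (l - l')}.
  move=> l l' ls l's ll'; have [j /andP[j0 jJ] zj] := sJ l l' ls l's ll'.
  exists j => //; rewrite j0 (leq_trans jJ)// (leq_trans (leq_maxr m0 J))// leq_addl//.
pose Q := \sum_(l <- s) nsq (inner (points K d) (fun t => (phi t)%:C%C) (fun t => expi (l * t))).
have GM2 : mean (points 0 (K + d)) (fun x => nsq (f x - p x)) * Mt ^+ 2 <= eps ^+ 2.
  apply: (@le_trans _ _ ((eps / Mt) ^+ 2 * Mt ^+ 2)).
    by rewrite ler_wpM2r ?sqr_ge0// ltW.
  by rewrite -exprMn divfK// gt_eqF//; lra.
have G0 : 0 <= mean (points 0 (K + d)) (fun x => nsq (f x - p x)).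
  by apply: mean_ge0 => x; exact: nsq_ge0.
have GM1 : mean (points 0 (K + d)) (fun x => nsq (f x - p x)) * Mt <= eps ^+ 2.
  by apply: le_trans GM2; rewrite expr2 mulrA ler_peMr// mulr_ge0//; lra.
have [etau tau1] : eps <= tau /\ tau <= 1.
  case/andP: tauP => h1 ->; split => //; apply: le_trans h1.
  have : eps * W = 1 / 10 by lra.
  nra.
have [tQ SA] := bump_projection_bound HNM Hodd (fset_uniq s) sZ eps0 etau tau1
  (ltac:(by rewrite yc) : (0 < count_mem y (points 0 K))%N) GM1.
exfalso; apply: (mass_contradiction (C := C) eps0 eW W9 tauP C1 _ Mt1 _ _ _ _ SA GM2 tQ).
- by apply: sumr_ge0 => l _; exact: nsq_ge0.
- by apply: sumr_ge0 => l _; exact: nsq_ge0.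
- exact: (@Bessel_multiplicity R N M n HNM Hodd K d phi s (fset_uniq s) sZ y1).
- have := @Bessel_colours R N M n HNM Hodd K d phi s (fset_uniq s) sZ c col.
  rewrite -/tau => h; apply: (@le_trans _ _ (c%:R * tau * W)).
    by rewrite ler_wpM2r//; lra.
  by rewrite mulrAC cW.
- exact: mean_bump_bound.
Qed.

End necessity.

(** * The closed span of a set of exponentials *)

Section span_closure.
Context {R : realType} (mu : probability R R) (L : set R).
Implicit Types (f g : R -> R[i]) (u v : R -> R) (l : seq (R[i] * R)).

Definition trig_sum l (x : R) : R[i] := \sum_(p <- l) p.1 * expi (p.2 * x).

Definition cmeas f : Prop :=
  measurable_fun setT (fun x => complex.Re (f x)) /\
  measurable_fun setT (fun x => complex.Im (f x)).

Definition sqdist f g : \bar R := (\int[mu]_x (nsq (f x - g x))%:E)%E.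

(** Trigonometric sums are given by lists of coefficients and frequencies, possibly
    with repetitions, so that sums of them are concatenations. *)
Definition in_span f : Prop := cmeas f /\
  forall eps : R, 0 < eps -> exists l,
    (forall p, p \in l -> L p.2) /\ (sqdist f (trig_sum l) < eps%:E)%E.

Lemma cbcont_cmeas f : cbcont f -> cmeas f.
Proof.
by move=> [[fr _] [fi _]]; split; exact: continuous_measurable_fun.
Qed.

Lemma cmeasD f g : cmeas f -> cmeas g -> cmeas (fun x => f x + g x).
Proof.
move=> [fr fi] [gr gi]; split.
  by under eq_fun do rewrite raddfD; exact: measurable_funD.
by under eq_fun do rewrite raddfD; exact: measurable_funD.
Qed.

Lemma cmeasM f g : cmeas f -> cmeas g -> cmeas (fun x => f x * g x).
Proof.
move=> [fr fi] [gr gi]; split.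
  rewrite (_ : (fun x => _) = fun x => complex.Re (f x) * complex.Re (g x) -
     complex.Im (f x) * complex.Im (g x)).
    by apply: measurable_funB; exact: measurable_funM.
  by apply/funext => x; case: (f x) (g x) => a b [c d].
rewrite (_ : (fun x => _) = fun x => complex.Re (f x) * complex.Im (g x) +
   (complex.Im (f x) * complex.Re (g x))).
  by apply: measurable_funD; exact: measurable_funM.
by apply/funext => x; case: (f x) (g x) => a b [c d].
Qed.

Lemma cmeas_cst (c : R[i]) : cmeas (fun=> c).
Proof. exact: cbcont_cmeas (cbcont_cst c). Qed.

Lemma cmeasB f g : cmeas f -> cmeas g -> cmeas (fun x => f x - g x).
Proof.
move=> mf mg; under eq_fun do rewrite -mulN1r.
by apply: cmeasD => //; apply: cmeasM => //; exact: cmeas_cst.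
Qed.

Lemma cmeas_real u : measurable_fun setT u -> cmeas (fun x => (u x)%:C%C).
Proof. by move=> mu'; split => //=; exact: measurable_cst. Qed.

Lemma cmeas_trig_sum l : cmeas (trig_sum l).
Proof.
by apply: cbcont_cmeas; exact: (cbcont_lincomb l (fun p => p.1) (fun p => p.2)).
Qed.

Lemma cmeas_nsq f : cmeas f -> measurable_fun setT (fun x => (nsq (f x))%:E).
Proof.
move=> [fr fi]; apply/measurable_EFinP; apply: measurable_funD; exact: measurable_funX.
Qed.

Lemma sqdistE f g h k : (forall x, f x - g x = h x - k x) -> sqdist f g = sqdist h k.
Proof. by move=> e; apply: eq_integral => x _; rewrite e. Qed.

Lemma sqdistD f f' g g' : cmeas f -> cmeas f' -> cmeas g -> cmeas g' ->
  (sqdist (fun x => f x + f' x)%R (fun x => g x + g' x)%R <=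
   2%:E * sqdist f g + 2%:E * sqdist f' g')%E.
Proof.
move=> mf mf' mg mg'.
have m1 := cmeas_nsq (cmeasB mf mg); have m2 := cmeas_nsq (cmeasB mf' mg').
rewrite /sqdist -!ge0_integralZl//; last 2 first.
- by move=> x _; rewrite lee_fin nsq_ge0.
- by move=> x _; rewrite lee_fin nsq_ge0.
rewrite -ge0_integralD//.
- apply: ge0_le_integral => //.
  + by move=> x _; rewrite lee_fin nsq_ge0.
  + by apply: cmeas_nsq; apply: cmeasB; exact: cmeasD.
  + by apply: emeasurable_funD; exact: measurable_funeM.
  + move=> x _; rewrite -!EFinM -EFinD lee_fin opprD addrACA; exact: nsqD_le.
- by move=> x _; rewrite -EFinM lee_fin mulr_ge0// nsq_ge0.
- exact: measurable_funeM.
- by move=> x _; rewrite -EFinM lee_fin mulr_ge0// nsq_ge0.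
- exact: measurable_funeM.
Qed.

Lemma sqdistD_lt f f' g g' (eps : R) :
  cmeas f -> cmeas f' -> cmeas g -> cmeas g' ->
  (sqdist f g < (eps / 4)%:E)%E -> (sqdist f' g' < (eps / 4)%:E)%E ->
  (sqdist (fun x => f x + f' x)%R (fun x => g x + g' x)%R < eps%:E)%E.
Proof.
move=> mf mf' mg mg' h1 h2; apply: (le_lt_trans (sqdistD mf mf' mg mg')).
have -> : eps%:E = ((2 * (eps / 4))%:E + (2 * (eps / 4))%:E)%E.
  by rewrite -EFinD; congr EFin; field.
by apply: lteD; rewrite EFinM lte_pmul2l.
Qed.

Lemma in_span_closed f : cmeas f ->
  (forall eps : R, 0 < eps -> exists2 g, in_span g & (sqdist f g < eps%:E)%E) -> in_span f.
Proof.
move=> mf fcl; split => // eps eps0.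
have e4 : 0 < eps / 4 by rewrite divr_gt0.
have [g [mg gcl] fg] := fcl _ e4; have [l [lL gl]] := gcl _ e4.
exists l; split => //.
rewrite (@sqdistE _ _ (fun x => f x + g x) (fun x => g x + trig_sum l x)).
  by apply: sqdistD_lt => //; exact: cmeas_trig_sum.
by move=> x; ring.
Qed.

Lemma in_spanD f g : in_span f -> in_span g -> in_span (fun x => f x + g x).
Proof.
move=> [mf fcl] [mg gcl]; split; first exact: cmeasD.
move=> eps eps0; have e4 : 0 < eps / 4 by rewrite divr_gt0.
have [l [lL fl]] := fcl _ e4; have [l' [l'L gl]] := gcl _ e4.
exists (l ++ l'); split.
  by move=> p; rewrite mem_cat => /orP[/lL|/l'L].
rewrite (@sqdistE _ _ (fun x => f x + g x) (fun x => trig_sum l x + trig_sum l' x)).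
  by apply: sqdistD_lt => //; exact: cmeas_trig_sum.
by move=> x; rewrite /trig_sum big_cat.
Qed.

Lemma in_spanZ (c : R[i]) f : in_span f -> in_span (fun x => c * f x).
Proof.
move=> [mf fcl]; split; first by apply: cmeasM => //; exact: cmeas_cst.
move=> eps eps0; have c0 : 0 < nsq c + 1 by rewrite ltr_wpDl// nsq_ge0.
have e4 : 0 < eps / (nsq c + 1) by rewrite divr_gt0.
have [l [lL fl]] := fcl _ e4.
exists [seq (c * p.1, p.2) | p <- l]; split.
  by move=> _ /mapP[p pl ->]; exact: (lL _ pl).
have -> : sqdist (fun x => c * f x) (trig_sum [seq (c * p.1, p.2) | p <- l]) =
    ((nsq c)%:E * sqdist f (trig_sum l))%E.
  rewrite /sqdist -ge0_integralZl//; last 3 first.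
  - by apply: cmeas_nsq; apply: cmeasB => //; exact: cmeas_trig_sum.
  - by move=> x _; rewrite lee_fin nsq_ge0.
  - by rewrite lee_fin nsq_ge0.
  apply: eq_integral => x _; rewrite -EFinM -nsqM mulrBr; congr ((nsq (_ - _))%:E).
  by rewrite /trig_sum big_map mulr_sumr; apply: eq_bigr => p _; rewrite mulrA.
apply: (@le_lt_trans _ _ ((nsq c)%:E * (eps / (nsq c + 1))%:E)%E).
  by rewrite lee_wpmul2l ?lee_fin ?nsq_ge0// ltW.
rewrite -EFinM lte_fin mulrCA gtr_pMr// ltr_pdivrMr// mul1r ltrDl//.
Qed.

(** Dominated convergence applied to the squares of the differences. *)
Lemma in_span_dominated (v : nat -> R -> R) u (h : R -> R) :
  (forall m, in_span (fun x => (v m x)%:C%C)) -> measurable_fun setT u ->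
  (forall x, v m x @[m --> \oo] --> u x) ->
  mu.-integrable setT (EFin \o h) -> (forall m x, (v m x - u x) ^+ 2 <= h x) ->
  in_span (fun x => (u x)%:C%C).
Proof.
move=> vs mu' vu hi vh; apply: in_span_closed; first exact: cmeas_real.
move=> eps eps0.
have mv m : measurable_fun setT (v m) by case: (vs m) => - [].
have mE m : measurable_fun setT (fun x => ((v m x - u x) ^+ 2)%:E).
  by apply/measurable_EFinP; apply: measurable_funX; exact: measurable_funB.
have [||_ _] := @dominated_convergence _ _ R mu setT measurableT
  (fun m x => ((v m x - u x) ^+ 2)%:E) (cst 0%E) (EFin \o h) mE (measurable_cst _) _ hi.
- apply: aeW => x _; apply: cvg_EFin; first exact: nearW.
  rewrite -[X in _ --> X](_ : (u x - u x) ^+ 2 = 0); last by rewrite subrr expr0n.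
  by under eq_fun do rewrite expr2; rewrite expr2; apply: cvgM; (apply: cvgB; [exact: vu|exact: cvg_cst]).
- by apply: aeW => x m _; rewrite /= lee_fin ger0_norm ?sqr_ge0.
rewrite integral0 => /fine_cvgP[vfin v0].
have [m1 _ Hm1] := vfin.
have [m2 _ Hm2] : \forall m \near \oo,
    fine (\int[mu]_x ((v m x - u x) ^+ 2)%:E)%E < eps.
  exact: (cvgr_lt _ v0).
exists (fun x => (v (maxn m1 m2) x)%:C%C); first exact: vs.
have -> : sqdist (fun x => (u x)%:C%C) (fun x => (v (maxn m1 m2) x)%:C%C) =
   (\int[mu]_x ((v (maxn m1 m2) x - u x) ^+ 2)%:E)%E.
  apply: eq_integral => x _; rewrite -rmorphB nsq_real -sqrrN opprB//.
have fin := Hm1 (maxn m1 m2) (leq_maxl _ _); rewrite /= in fin.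
rewrite -(fineK fin) lte_fin.
exact: (Hm2 (maxn m1 m2) (leq_maxr _ _)).
Qed.

End span_closure.

(** * Polynomials converging to a step *)

Section step.
Context {R : realType}.
Implicit Types (u : R) (m : nat).

(** The polynomials of Brosowski and Deutsch's proof of the Stone--Weierstrass theorem;
    on [0, 1] they tend to 1 below 1/2 and to 0 above. *)
Definition step_poly m u : R := (1 - u ^+ m) ^+ (2 ^ m).

Definition step u : R := limn (fun m => step_poly m u).

Lemma step_poly01 m u : 0 <= u <= 1 -> 0 <= step_poly m u <= 1.
Proof.
move=> /andP[u0 u1]; have h0 : 0 <= u ^+ m by rewrite exprn_ge0.
have h1 : u ^+ m <= 1 by rewrite exprn_ile1.
by rewrite exprn_ge0 ?exprn_ile1//; lra.
Qed.

Lemma Bernoulli_sub (a : R) m : 0 <= a <= 1 -> 1 - m%:R * a <= (1 - a) ^+ m.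
Proof.
move=> /andP[a0 a1]; elim: m => [|m IH]; first by rewrite mul0r subr0.
have p1 : (1 - a) ^+ m <= 1 by rewrite exprn_ile1//; lra.
rewrite exprSr -natr1; nra.
Qed.

Lemma Bernoulli_add (a : R) m : 0 <= a -> 1 + m%:R * a <= (1 + a) ^+ m.
Proof.
move=> a0; elim: m => [|m IH]; first by rewrite mul0r addr0.
have h : 0 <= m%:R * a by rewrite mulr_ge0.
rewrite exprSr -natr1; nra.
Qed.

Lemma step_poly_cvg1 u : 0 <= u -> u < 1 / 2 ->
  step_poly m u @[m --> \oo] --> (1 : R).
Proof.
move=> u0 u2; apply: (@squeeze_cvgr _ _ _ _ (fun m => 1 - (2 * u) ^+ m) (fun=> 1)).
- apply: nearW => m; have /andP[_ ->] : 0 <= step_poly m u <= 1.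
    by apply: step_poly01; lra.
  rewrite andbT exprMn -natrX; apply: Bernoulli_sub.
  by rewrite exprn_ge0//= exprn_ile1//; lra.
- rewrite -[X in _ --> X]subr0; apply: cvgB; first exact: cvg_cst.
  by apply: cvg_expr; rewrite ger0_norm; lra.
- exact: cvg_cst.
Qed.

Lemma step_poly_cvg0 u : 1 / 2 < u -> u <= 1 ->
  step_poly m u @[m --> \oo] --> (0 : R).
Proof.
move=> u2 u1; apply: (@squeeze_cvgr _ _ _ _ (fun=> 0) (fun m => (2 * u)^-1 ^+ m)).
- apply: nearW => m; have -> /= : 0 <= step_poly m u.
    by have /andP[] : 0 <= step_poly m u <= 1 by apply: step_poly01; lra.
  have u0 : 0 <= u ^+ m <= 1 by rewrite exprn_ge0 ?exprn_ile1//; lra.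
  have v0 : 0 < (2 * u) ^+ m by rewrite exprn_gt0//; lra.
  have := @Bernoulli_add (u ^+ m) (2 ^ m) (proj1 (andP u0)).
  rewrite natrX -exprMn => hB.
  have q0 : 0 <= step_poly m u.
    by have /andP[] : 0 <= step_poly m u <= 1 by apply: step_poly01; lra.
  rewrite exprVn -[leRHS]mul1r ler_pdivlMr//.
  apply: (@le_trans _ _ (step_poly m u * (1 + u ^+ m) ^+ (2 ^ m))).
    by rewrite ler_wpM2l//; lra.
  rewrite -exprMn exprn_ile1//; case/andP: u0 => h0 h1; nra.
- exact: cvg_cst.
- apply: cvg_expr; rewrite ger0_norm ?invr_ge0; last by lra.
  by rewrite invf_lt1; lra.
Qed.

(** At 1/2 itself the sequence is nondecreasing and bounded. *)
Lemma step_poly_cvg u : 0 <= u <= 1 ->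
  step_poly m u @[m --> \oo] --> step u.
Proof.
move=> /[dup] u01 /andP[u0 u1].
have [u2|u2|u2] := ltgtP u (1 / 2).
- exact: cvgP (step_poly_cvg1 u0 u2).
- exact: cvgP (step_poly_cvg0 u2 u1).
- apply: nondecreasing_is_cvgn.
    apply/nondecreasing_seqP => m; rewrite /step_poly expnS exprM.
    have h : 0 <= u ^+ m <= 1 by rewrite exprn_ge0 ?exprn_ile1.
    have e : (1 - u ^+ m.+1) ^+ 2 = 1 - u ^+ m + (u ^+ m / 2) ^+ 2.
      by rewrite (exprS u); move: (u ^+ m) => x; rewrite u2; field.
    rewrite ler_pXn2r ?nnegrE ?expn_gt0//; [|lra|exact: sqr_ge0].
    by rewrite e lerDl sqr_ge0.
  by exists 1 => _ [m _ <-]; case/andP: (step_poly01 m u01).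
Qed.

Lemma step01 u : 0 <= u <= 1 -> 0 <= step u <= 1.
Proof.
move=> u01; have cu := step_poly_cvg u01; apply/andP; split.
  by apply: (cvgr_to_ge cu); apply: nearW => m; case/andP: (step_poly01 m u01).
by apply: (cvgr_to_le cu); apply: nearW => m; case/andP: (step_poly01 m u01).
Qed.

Lemma step1 u : 0 <= u -> u < 1 / 2 -> step u = 1.
Proof. by move=> u0 u2; apply: cvg_lim => //; exact: step_poly_cvg1. Qed.

Lemma step0 u : 1 / 2 < u -> u <= 1 -> step u = 0.
Proof. by move=> u2 u1; apply: cvg_lim => //; exact: step_poly_cvg0. Qed.

End step.

(** * Density of the exponentials *)

Section density.
Context {R : realType} (mu : probability R R) (L : set R).
Implicit Types (u v : R -> R).
Hypothesis exp_span : forall xi : R, in_span mu L (fun x => expi (xi * x)).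
Local Notation rspan u := (in_span mu L (fun x => (u x)%:C%C)).

Definition trig_poly u : Prop := exists l, forall x, (u x)%:C%C = trig_sum l x.

Lemma trig_polyD u v : trig_poly u -> trig_poly v -> trig_poly (fun x => u x + v x).
Proof.
move=> [l lE] [l' l'E]; exists (l ++ l') => x.
by rewrite rmorphD /= lE l'E /trig_sum big_cat.
Qed.

Lemma trig_polyM u v : trig_poly u -> trig_poly v -> trig_poly (fun x => u x * v x).
Proof.
move=> [l lE] [l' l'E]; exists [seq (p.1 * q.1, p.2 + q.2) | p <- l, q <- l'] => x.
rewrite rmorphM /= lE l'E /trig_sum big_allpairs_dep mulr_suml.
apply: eq_bigr => p _; rewrite mulr_sumr; apply: eq_bigr => q _.
by rewrite /= mulrDl expiD; ring.
Qed.

Lemma trig_poly_cst c : trig_poly (fun=> c).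
Proof.
by exists [:: (c%:C%C, 0)] => x; rewrite /trig_sum big_seq1 mul0r expi0 mulr1.
Qed.

Lemma trig_polyN u : trig_poly u -> trig_poly (fun x => - u x).
Proof.
move=> [l lE]; exists [seq (- p.1, p.2) | p <- l] => x.
rewrite rmorphN /= lE /trig_sum big_map -sumrN.
by apply: eq_bigr => p _; rewrite mulNr.
Qed.

Lemma trig_polyX u m : trig_poly u -> trig_poly (fun x => u x ^+ m).
Proof.
move=> tu; elim: m => [|m IH]; first exact: trig_poly_cst.
by under eq_fun do rewrite exprS; exact: trig_polyM.
Qed.

Lemma trig_poly_sin s b : trig_poly (fun x => sin (2 * pi * (s * (x - b)))).
Proof.
exists [:: (Complex 0 (1 / 2) * expi (- (s * b)), s);
           (- Complex 0 (1 / 2) * expi (s * b), - s)] => x.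
rewrite /trig_sum big_cons big_seq1 /=; rewrite -[X in _ = X + _]mulrA -[X in _ = _ + X]mulrA -!expiD.
have -> : - (s * b) + s * x = s * (x - b) by ring.
have -> : s * b + - s * x = - (s * (x - b)) by ring.
rewrite /expi mulrN cosN sinN opprK; simpc; congr Complex; lra.
Qed.

Lemma rspan_trig u : trig_poly u -> rspan u.
Proof.
move=> [l lE]; rewrite (_ : (fun x => _) = trig_sum l); last exact/funext.
elim: l {lE u} => [|p l IH].
  rewrite (_ : trig_sum [::] = fun x => 0 * expi (0 * x)).
    by apply: in_spanZ; exact: exp_span.
  by apply/funext => x; rewrite /trig_sum big_nil mul0r.
rewrite (_ : trig_sum (p :: l) = fun x => p.1 * expi (p.2 * x) + trig_sum l x).
  by apply: in_spanD => //; apply: in_spanZ; exact: exp_span.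
by apply/funext => x; rewrite /trig_sum big_cons.
Qed.

Lemma rspan_measurable u : rspan u -> measurable_fun setT u.
Proof. by case=> - []. Qed.

Lemma rspanD u v : rspan u -> rspan v -> rspan (fun x => u x + v x).
Proof. by move=> ru rv; under eq_fun do rewrite rmorphD; exact: in_spanD. Qed.

Lemma rspanZ (c : R) u : rspan u -> rspan (fun x => c * u x).
Proof. by move=> ru; under eq_fun do rewrite rmorphM; exact: in_spanZ. Qed.

Lemma rspan_sum (I : Type) (r : seq I) (F : I -> R -> R) :
  (forall i, rspan (F i)) -> rspan (fun x => \sum_(i <- r) F i x).
Proof.
move=> rF; elim: r => [|i r IH].
  by under eq_fun do rewrite big_nil; apply: rspan_trig; exact: trig_poly_cst.
by under eq_fun do rewrite big_cons; exact: rspanD.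
Qed.

Lemma rspan_bounded_limit (v : nat -> R -> R) u :
  (forall m, rspan (v m)) -> (forall m x, 0 <= v m x <= 1) ->
  (forall x, v m x @[m --> \oo] --> u x) -> rspan u.
Proof.
move=> rv v01 vu.
have u01 x : 0 <= u x <= 1.
  apply/andP; split.
    by apply: (cvgr_to_ge (vu x)); apply: nearW => m; case/andP: (v01 m x).
  by apply: (cvgr_to_le (vu x)); apply: nearW => m; case/andP: (v01 m x).
apply: (in_span_dominated rv _ vu (h := cst 1)).
- by apply: measurable_fun_cvg => [m|x _]; [exact: rspan_measurable (rv m)|exact: vu].
- exact: finite_measure_integrable_cst.
- move=> m x; have /andP[h0 h1] := v01 m x; have /andP[h2 h3] := u01 x.
  by rewrite /cst; nra.
Qed.

(** The wave is below 1/2 exactly where the sine is positive.  As [s] tends to 0, this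
    includes every point to the right of [b] and excludes every point to its left. *)
Let wave (s b x : R) : R := (1 - sin (2 * pi * (s * (x - b)))) / 2.

Let wave01 s b x : 0 <= wave s b x <= 1.
Proof.
have := sin_geN1 (2 * pi * (s * (x - b))); have := sin_le1 (2 * pi * (s * (x - b))).
rewrite /wave; lra.
Qed.

Lemma rspan_step s b : rspan (fun x => step (wave s b x)).
Proof.
apply: (rspan_bounded_limit (v := fun m x => step_poly m (wave s b x))).
- move=> m; apply: rspan_trig; rewrite /step_poly; apply: trig_polyX.
  apply: trig_polyD; first exact: trig_poly_cst.
  apply: trig_polyN; apply: trig_polyX; rewrite /wave; apply: trig_polyM; last exact: trig_poly_cst.
  apply: trig_polyD; first exact: trig_poly_cst.
  by apply: trig_polyN; exact: trig_poly_sin.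
- by move=> m x; exact: step_poly01.
- by move=> x; exact: step_poly_cvg.
Qed.

Let half (a b x : R) : R := if b < x then 1 else if x < b then 0 else a.

Lemma rspan_half b : rspan (half (step (1 / 2)) b).
Proof.
apply: (rspan_bounded_limit (v := fun m x => step (wave (m.+1%:R^-1) b x))).
- by move=> m; exact: rspan_step.
- by move=> m x; apply: step01; exact: wave01.
- move=> x; rewrite /half.
  have angle : 0 < `|x - b| -> \forall m \near \oo,
      0 < 2 * pi * (m.+1%:R^-1 * `|x - b|) < pi.
    move=> xb; near=> m.
    have m0 : 0 < m.+1%:R :> R by [].
    have mb : 2 * `|x - b| < m.+1%:R.
      apply: (@lt_trans _ _ m%:R); last by rewrite ltr_nat.
      near: m; exact: nbhs_infty_gtr.
    apply/andP; split.
      by rewrite !mulr_gt0 ?pi_gt0 ?invr_gt0.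
    rewrite -mulrA mulrCA gtr_pMr ?pi_gt0// mulrCA mulrC ltr_pdivrMr// mul1r.
    done.
  have [bx|xb|<-] := ltgtP b x.
  + apply: cvg_near_cst; near=> m.
    apply: step1; first by case/andP: (wave01 (m.+1%:R^-1) b x).
    have : 0 < 2 * pi * (m.+1%:R^-1 * `|x - b|) < pi.
      by near: m; apply: angle; rewrite normr_gt0 subr_eq0 gt_eqF.
    by rewrite gtr0_norm ?subr_gt0// => /sin_gt0_pi; rewrite /wave; lra.
  + apply: cvg_near_cst; near=> m.
    apply: step0; last by case/andP: (wave01 (m.+1%:R^-1) b x).
    have : 0 < 2 * pi * (m.+1%:R^-1 * `|x - b|) < pi.
      by near: m; apply: angle; rewrite normr_gt0 subr_eq0 lt_eqF.
    rewrite ltr0_norm ?subr_lt0// => /sin_gt0_pi; rewrite !mulrN sinN /wave; lra.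
  + under eq_fun do rewrite /wave subrr !mulr0 sin0 subr0.
    exact: cvg_cst.
Unshelve. all: by end_near. Qed.

(** Approaching [b] from the right gets rid of the unknown value at the end point. *)
Lemma rspan_ray b : rspan (\1_(`]b, +oo[%classic) : R -> R).
Proof.
apply: (rspan_bounded_limit (v := fun m => half (step (1 / 2)) (b + m.+1%:R^-1))).
- by move=> m; exact: rspan_half.
- move=> m x; rewrite /half; case: ifP => _; first by rewrite ler01 lexx.
  case: ifP => _; first by rewrite ler01 lexx.
  by apply: step01; lra.
- move=> x; apply: cvg_near_cst; have [bx|xb] := ltP b x.
    rewrite indicE mem_set/=; last by rewrite in_itv/= bx.
    near=> m; rewrite /half -ltrBrDl ifT//.
    have xb0 : 0 < x - b by rewrite subr_gt0.
    rewrite invf_plt ?posrE//; apply: (@lt_trans _ _ m%:R); last by rewrite ltr_nat.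
    near: m; exact: nbhs_infty_gtr.
  rewrite indicE memNset/=; last by rewrite in_itv/= andbT; apply/negP; rewrite -leNgt.
  apply: nearW => m; rewrite /half.
  have xbm : x < b + m.+1%:R^-1 by rewrite (le_lt_trans xb)// ltrDl invr_gt0.
  by rewrite ltNge (ltW xbm)/= xbm.
Unshelve. all: by end_near. Qed.

(** Rays are stable under intersection and generate the Borel sets, and the closed span
    contains complements and disjoint countable unions. *)
Lemma rspan_indic (A : set R) : measurable A -> rspan (\1_A : R -> R).
Proof.
move=> mA.
pose G := @RGenOInfty.G R.
have mE : @measurable _ (measurableTypeR R) = <<s G >>.
  exact: RGenOInfty.measurableE.
apply: (@dynkin_induction _ (measurableTypeR R) G (fun A => rspan (\1_A : R -> R))) => //.
- move=> _ _ [x ->] [y ->]; exists (Num.max x y).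
  apply/seteqP; split => z /=; rewrite !in_itv/= !andbT gt_max.
    by move=> [-> ->].
  by move/andP.
- apply: rspan_trig; rewrite indicT; exact: trig_poly_cst.
- by move=> _ [x ->]; exact: rspan_ray.
- move=> S mS rS.
  rewrite (_ : \1_(~` S) = fun x => 1 + (-1) * \1_S x).
    by apply: rspanD; [apply: rspan_trig; exact: trig_poly_cst|exact: rspanZ].
  by apply/funext => x; rewrite !indicE in_setC; case: (x \in S) => /=; ring.
- move=> F mF tF rF.
  have out x m : ~ (\bigcup_k F k) x -> \sum_(k < m) \1_(F k) x = 0 :> R.
    move=> nFx; apply: big1 => k _; rewrite indicE memNset// => Fx.
    by apply: nFx; exists (val k).
  have inside x k0 m : F k0 x -> \sum_(k < m) \1_(F k) x = (k0 < m)%N%:R :> R.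
    move=> Fk0; have FE k : \1_(F k) x = (k == k0)%:R :> R.
      rewrite indicE; case: eqVneq => [->|kk0]; first by rewrite mem_set.
      rewrite memNset// => Fk; move/eqP: kk0; apply.
      by apply: (tF k k0) => //; exists x.
    rewrite -(big_mkord xpredT (fun k => \1_(F k) x)).
    rewrite (eq_bigr (fun k => (k == k0)%:R)); last by move=> k _; exact: FE.
    elim: m => [|m IH]; first by rewrite big_geq.
    rewrite big_nat_recr//= IH ltnS [in RHS]leq_eqVlt (eq_sym m).
    by case: (eqVneq k0 m) => [->|_] /=; rewrite ?ltnn ?add0r ?addr0.
  apply: (rspan_bounded_limit (v := fun m x => \sum_(k < m) \1_(F k) x)).
  + by move=> m; apply: rspan_sum => k; exact: rF.
  + move=> m x; have [[k0 _ Fk0]|nFx] := pselect ((\bigcup_k F k) x).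
      by rewrite (inside _ k0)//; case: (k0 < m)%N; rewrite ?ler01 lexx.
    by rewrite out// lexx ler01.
  + move=> x; apply: cvg_near_cst; have [Fx|nFx] := pselect ((\bigcup_k F k) x).
      rewrite indicE mem_set//; have [k0 _ Fk0] := Fx.
      by exists k0.+1 => // m /= km; rewrite (inside _ k0)// km.
    by apply: nearW => m; rewrite out// indicE memNset.
- by rewrite -mE.
Qed.

Import HBNNSimple.

Lemma rspan_ge0 u : measurable_fun setT u -> (forall x, 0 <= u x) ->
  mu.-integrable setT (EFin \o (fun x => u x ^+ 2)) -> rspan u.
Proof.
move=> mu' u0 ui; have mEu : measurable_fun setT (EFin \o u) by exact/measurable_EFinP.
have [g [gnd gcv]] := approximation measurableT mEu (fun x _ => u0 x : (0 <= (EFin \o u) x)%E).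
have gu x : g m x @[m --> \oo] --> u x.
  by have := gcv x Logic.I; move/fine_cvgP => [_]; apply.
have gle m x : g m x <= u x.
  have nd : nondecreasing_seq (fun m => g m x).
    by move=> a b ab; have /lefP := gnd a b ab; exact.
  have := nondecreasing_cvgn_le nd (cvgP _ (gu x)) m.
  by rewrite (cvg_lim _ (gu x)).
apply: (in_span_dominated _ mu' gu ui).
- move=> m; rewrite (_ : (fun x => _) = fun x => (\sum_(i < #|` fset_set (range (g m))|)
    (fset_set (range (g m)))`_i * \1_(g m @^-1` [set (fset_set (range (g m)))`_i]) x)%:C%C).
    apply: rspan_sum => i; apply: rspanZ; apply: rspan_indic.
    exact: measurable_sfunP.
  by apply/funext => x; rewrite fimfunEord.
- move=> m x; have h1 := gle m x; have h2 : 0 <= g m x by exact: fun_ge0.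
  by have := u0 x; nra.
Qed.

Theorem in_span_L2 (f : R -> R[i]) : in_L2 mu f -> in_span mu L f.
Proof.
move=> [fr fi /L2norm_ltyP fn].
have real u : measurable_fun setT u -> (forall x, u x ^+ 2 <= nsq (f x)) -> rspan u.
  move=> mu' uf.
  have part (w : R -> R) : measurable_fun setT w -> (forall x, 0 <= w x) ->
      (forall x, w x ^+ 2 <= u x ^+ 2) -> rspan w.
    move=> mw w0 wu; apply: rspan_ge0 => //; apply/integrableP; split.
      by apply/measurable_EFinP; exact: measurable_funX.
    apply: le_lt_trans fn; apply: ge0_le_integral => //.
    - apply: measurableT_comp => //; apply/measurable_EFinP; exact: measurable_funX.
    - by apply: (@cmeas_nsq R).
    - move=> x _; rewrite /= lee_fin ger0_norm ?sqr_ge0//.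
      exact: le_trans (wu x) (uf x).
  rewrite (_ : (fun x => _) = fun x => (Num.max (u x) 0 + (-1) * Num.max (- u x) 0)%:C%C).
    apply: rspanD; last apply: rspanZ.
      apply: part; first exact: measurable_maxr.
        by move=> x; rewrite le_max lexx orbT.
      move=> x; case: (leP (u x) 0) => ux; last exact: lexx.
      by rewrite expr0n sqr_ge0.
    apply: part; first by apply: measurable_maxr => //; exact: measurable_funN.
      by move=> x; rewrite le_max lexx orbT.
    move=> x; case: (leP (- u x) 0) => ux; last by rewrite sqrrN.
    by rewrite expr0n sqr_ge0.
  apply/funext => x; congr (_%:C%C).
  by case: (leP (u x) 0) => ux; case: (leP (- u x) 0) => nux; lra.
rewrite (_ : f = fun x => (complex.Re (f x))%:C%C + Complex 0 1 * (complex.Im (f x))%:C%C).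
  apply: in_spanD; last apply: in_spanZ; apply: real => // x.
    by rewrite /nsq lerDl sqr_ge0.
  by rewrite /nsq lerDr sqr_ge0.
by apply/funext => x; case: (f x) => a b; simpc.
Qed.

End density.

(** * The spectrum in the divisible case *)

Lemma cvg_sum_seq (R : realType) (I : Type) (r : seq I) (u : I -> nat -> R) (v : I -> R) :
  (forall i, u i d @[d --> \oo] --> v i) ->
  \sum_(i <- r) u i d @[d --> \oo] --> \sum_(i <- r) v i.
Proof.
move=> uv; elim: r => [|i r IH].
  by under eq_fun do rewrite big_nil; rewrite big_nil; exact: cvg_cst.
by under eq_fun do rewrite big_cons; rewrite big_cons; apply: cvgD.
Qed.

Lemma nondecreasing_tail (R : realType) (u : nat -> R) (C eps : R) :
  nondecreasing_seq u -> (forall m, u m <= C) -> 0 < eps ->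
  exists K1, forall K, (K1 <= K)%N -> forall m, u m - u K <= eps.
Proof.
move=> und uC eps0; have ucv : cvgn u.
  by apply: nondecreasing_is_cvgn => //; exists C => _ [m _ <-].
have Se : limn u - eps < limn u by rewrite ltrBlDr ltrDl.
have [K1 _ HK1] := cvgr_gt _ ucv _ Se.
exists K1 => K K1K m; have := HK1 K K1K => /=.
by have := nondecreasing_cvgn_le und ucv m; lra.
Qed.

Section sufficiency.
Context {R : realType} (mu : probability R R).
Variables (N M n : nat -> nat) (B : nat -> {fset int}).
Hypothesis HNM : forall k, (1 <= k)%N -> (3 <= M k <= N k)%N.
Hypothesis Hodd : forall k, (1 <= k)%N -> odd (M k).
Hypothesis HB : forall k, (1 <= k)%N -> B k = digits (M k) (n k).
Hypothesis Hmu : infinite_convolution N B mu.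
Hypothesis Hsum : (\sum_(1 <= k <oo) (((M k)%:R : R)^-1)%:E < +oo)%E.
Hypothesis Hdvd : forall k, (2 <= k)%N -> (M k %| N k)%N.
Local Notation points := (@points R N M n).
Local Notation zero_at := (@zero_at R N M).
Local Notation scale := (scale N).
Local Notation transform := (@transform R N M n).

(** The multiples of [scale k / M k] by the integers of absolute value at most
    [(M k - 1) / 2]: being centred keeps the frequencies where the tail transforms
    are bounded below. *)
Definition frequency_level k : seq R :=
  [seq (i%:R - ((M k).-1./2)%:R) * ((scale k)%:R / (M k)%:R) | i <- iota 0 (M k)].

Fixpoint frequencies m : seq R :=
  if m is m'.+1 then [seq x + a | x <- frequencies m', a <- frequency_level m]
  else [:: 0].

Let P0 k : 0 < (scale k)%:R :> R := scaleR_gt0 HNM k.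
Let Mk0 k : 0 < (M k.+1)%:R :> R.
Proof. by rewrite ltr0n (M_gt0 HNM). Qed.

Lemma frequencies_sub m K : (m <= K)%N -> {subset frequencies m <= frequencies K}.
Proof.
elim: K => [|K IH]; first by rewrite leqn0 => /eqP ->.
rewrite leq_eqVlt => /orP[/eqP->//|]; rewrite ltnS => mK x /(IH mK) xK.
rewrite -[x]addr0; apply: allpairs_f => //.
apply/mapP; exists ((M K.+1).-1./2); last by rewrite subrr mul0r.
by rewrite mem_iota add0n; have := M_gt0 HNM K; lia.
Qed.

(** The last level contributes at most [(1 - 1 / M) P / 2] and the preceding ones
    at most half the preceding scale, which is no more than [P / M / 2]. *)
Lemma frequencies_bound m x : x \in frequencies m -> `|x| <= (scale m)%:R / 2.
Proof.
elim: m x => [|m IH] x; first by rewrite inE => /eqP ->; rewrite normr0 divr_ge0.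
move=> /allpairsP[[y a] /= [/IH yb /mapP[i + ->] ->]].
rewrite mem_iota add0n => /andP[_ iM].
apply: (le_trans (ler_normD _ _)).
have ib : `|i%:R - (M m.+1).-1./2%:R| <= ((M m.+1)%:R - 1) / 2 :> R.
  have hM : (M m.+1)%:R = (M m.+1).-1./2%:R * 2 + 1 :> R.
    rewrite -natrM natr1; congr _%:R.
    by have := Hodd (isT : (0 < m.+1)%N); have := M_gt0 HNM m; lia.
  have i1 : i%:R <= (M m.+1)%:R - 1 :> R by rewrite lerBrDr natr1 ler_nat.
  have i0 : 0 <= i%:R :> R by [].
  by rewrite ler_norml; apply/andP; split; lra.
have q0 : 0 <= (scale m.+1)%:R / (M m.+1)%:R :> R by rewrite divr_ge0.
rewrite normrM (ger0_norm q0).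
have PM : (scale m)%:R <= (scale m.+1)%:R / (M m.+1)%:R :> R.
  by rewrite ler_pdivlMr// scaleS natrM ler_pM2l// ler_nat (M_leN HNM).
have h := ler_wpM2r q0 ib.
have e : ((M m.+1)%:R - 1) / 2 * ((scale m.+1)%:R / (M m.+1)%:R) =
   (scale m.+1)%:R / 2 - (scale m.+1)%:R / (M m.+1)%:R / 2 :> R.
  by field; rewrite gt_eqF.
by rewrite e in h; lra.
Qed.

(** Divisibility enters here: the step of a level is a multiple of all the previous
    scales. *)
Lemma frequency_level_period m j a : (0 < j <= m)%N -> a \in frequency_level m.+1 ->
  a / (scale j)%:R \is a Num.int.
Proof.
move=> /andP[j0 jm] /mapP[i _ ->].
have /dvdnP[q qE] : (M m.+1 %| N m.+1)%N by apply: Hdvd; lia.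
have /dvdnP[r rE] : (scale j %| scale m)%N by rewrite -(subnKC jm) scale_dvd.
have -> : (i%:R - (M m.+1).-1./2%:R) * ((scale m.+1)%:R / (M m.+1)%:R) / (scale j)%:R =
    (i%:R - (M m.+1).-1./2%:R) * (r%:R * q%:R) :> R.
  by rewrite scaleS rE qE !natrM; field; rewrite !gt_eqF.
by apply: rpredM; [apply: rpredB; exact: natr_int|apply: rpredM; exact: natr_int].
Qed.

Lemma zero_at_shift k x y : y / (scale k)%:R \is a Num.int ->
  zero_at k x -> zero_at k (x + y).
Proof.
move=> yk [xk nxk]; split; first by rewrite mulrDl mulrDr rpredD// rpredM// natr_int.
apply: contra nxk => xyk; rewrite -(addrK y x) mulrBl; exact: rpredB.
Qed.

Lemma zero_at0 k : ~ zero_at k 0.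
Proof. by move=> [_]; rewrite mul0r rpred0. Qed.

Lemma frequency_level_zero m a b : a \in frequency_level m.+1 ->
  b \in frequency_level m.+1 -> a != b -> zero_at m.+1 (a - b).
Proof.
move=> /mapP[i + ->] /mapP[j + ->]; rewrite !mem_iota !add0n => /andP[_ iM] /andP[_ jM] ab.
have ij : i != j by apply: contra ab => /eqP ->.
set h : R := (M m.+1).-1./2%:R.
have e : ((i%:R - h) * ((scale m.+1)%:R / (M m.+1)%:R) -
    (j%:R - h) * ((scale m.+1)%:R / (M m.+1)%:R)) / (scale m.+1)%:R =
    (i%:Z - j%:Z)%:~R / (M m.+1)%:R.
  by rewrite intrD mulrNz -!pmulrn; field; rewrite !gt_eqF.
split; rewrite e; first by rewrite mulrC divfK ?intr_int// gt_eqF.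
apply/negP => /intrP[w] /(congr1 (fun t => t * (M m.+1)%:R)).
have -> : w%:~R * (M m.+1)%:R = (w * (M m.+1)%:Z)%:~R :> R by rewrite intrM -pmulrn.
rewrite divfK ?gt_eqF// => /eqP; rewrite eqr_int => /eqP ijw.
have [w0|[w0|w0]] : w = 0 \/ 1 <= w \/ w <= -1 by lia.
- by move: ijw ij; rewrite w0; lia.
- by nia.
- by nia.
Qed.

(** The highest level is invisible to the zero set that separates [x] from [y]; when
    these agree, it separates by itself. *)
Lemma frequencies_pair m x y a b : 
  {in frequencies m &, forall x y, x != y -> exists2 k, (0 < k <= m)%N & zero_at k (x - y)} ->
  x \in frequencies m -> y \in frequencies m ->
  a \in frequency_level m.+1 -> b \in frequency_level m.+1 -> (x, a) != (y, b) ->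
  exists2 k, (0 < k <= m.+1)%N & zero_at k (x + a - (y + b)).
Proof.
move=> IH xm ym am bm xayb; have [xy|xy] := eqVneq x y.
  exists m.+1; first by rewrite leqnn.
  rewrite xy opprD addrACA subrr add0r; apply: frequency_level_zero => //.
  by apply: contra xayb; rewrite xy => /eqP ->.
have [k km zk] := IH x y xm ym xy; exists k; first lia.
rewrite opprD addrACA; apply: zero_at_shift zk.
by rewrite mulrBl; apply: rpredB; exact: frequency_level_period km _.
Qed.

Lemma frequencies_zero m :
  {in frequencies m &, forall x y, x != y -> exists2 k, (0 < k <= m)%N & zero_at k (x - y)}.
Proof.
elim: m => [|m IH] x y.
  by rewrite !inE => /eqP -> /eqP ->; rewrite eqxx.
move=> /allpairsP[[x1 a] /= [x1m am ->]] /allpairsP[[y1 b] /= [y1m bm ->]] ne.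
apply: frequencies_pair => //; apply: contra ne => /eqP[-> ->].
by [].
Qed.

Lemma frequencies_uniq m : uniq (frequencies m).
Proof.
elim: m => // m IH; apply: allpairs_uniq => //.
  rewrite map_inj_uniq ?iota_uniq// => i j /mulIf.
  by rewrite mulf_neq0 ?invr_eq0 ?gt_eqF// => /(_ isT)/addIr/eqP; rewrite eqr_nat => /eqP.
move=> [x a] [y b] /allpairsP[[x1 a1] /= [x1m am [-> ->]]].
move=> /allpairsP[[y1 b1] /= [y1m bm [-> ->]]] xy.
apply/eqP; apply: contraT => ne.
have [k _] := frequencies_pair (@frequencies_zero m) x1m y1m am bm ne.
by rewrite xy subrr => /zero_at0.
Qed.

Lemma transform_periodic d x a : (forall j, (0 < j <= d)%N -> a / (scale j)%:R \is a Num.int) ->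
  transform 0 d (x + a) = transform 0 d x.
Proof.
elim: d => [|d IH] ha; first by rewrite !transform0.
rewrite !(transformS n HNM) IH; last by move=> j jd; apply: ha; lia.
by rewrite add0n mulrDl mask_periodic//; apply: ha; rewrite leqnn.
Qed.

(** Each level of frequencies runs over the classes of [1 / M] modulo 1 in the
    argument of its own mask, and over periods of the preceding ones. *)
Lemma frequencies_Parseval m x :
  \sum_(l <- frequencies m) nsq (transform 0 m (x + l)) = 1.
Proof.
elim: m x => [|m IH] x; first by rewrite big_seq1 transform0 nsq1.
rewrite /= big_allpairs_dep -[RHS](IH x); apply: eq_big_seq => l _.
transitivity (\sum_(a <- frequency_level m.+1) nsq (transform 0 m (x + l)) *
    nsq (mask (M m.+1) (n m.+1) ((x + l + a) / (scale m.+1)%:R))).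
  apply: eq_big_seq => a am; rewrite addrA (transformS n HNM) add0n nsqM transform_periodic//.
  by move=> j jm; exact: frequency_level_period jm am.
rewrite -mulr_sumr -[RHS]mulr1; congr (_ * _).
rewrite big_map -[X in iota 0 X](subn0 (M m.+1)) -/(index_iota 0 (M m.+1)) big_mkord.
rewrite -[RHS](mask_Parseval (n m.+1) ((x + l) / (scale m.+1)%:R - (M m.+1).-1./2%:R / (M m.+1)%:R) (M_gt0 HNM m)).
by apply: eq_bigr => i _; congr (nsq (mask _ _ _)); field; rewrite !gt_eqF.
Qed.

Lemma transformN K d x : transform K d (- x) = ((transform K d x)^*)%C.
Proof. by rewrite /transform mean_conj; apply: eq_mean => t _; rewrite mulNr expiN. Qed.

Lemma frequencies_ParsevalN m x :
  \sum_(l <- frequencies m) nsq (transform 0 m (x - l)) = 1.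
Proof.
rewrite -[RHS](frequencies_Parseval m (- x)); apply: eq_bigr => l _.
by rewrite -nsq_conj -transformN opprB addrC.
Qed.

(** The squared norm of the projection of an exponential onto the frequencies of
    level [m]. *)
Let energy x m := \sum_(l <- frequencies m) nsq (fourier mu (x - l)).

(** The squared distance from an exponential to the span of finitely many
    orthonormal ones. *)
Lemma expi_span_dist x m :
  \int[mu]_t nsq (expi (x * t) - \sum_(l <- frequencies m) fourier mu (x - l) * expi (l * t))
  = 1 - energy x m.
Proof.
set F := fun t => nsq _.
have bF : bcont F.
  apply: cbcont_nsq; apply: cbcontD; first exact: cbcont_expi.
  by apply: cbcontN; exact: (cbcont_lincomb _ _ (fun l => l)).
have cv := mean_cvg HNM HB Hmu bF.
have cv2 : mean (points 0 d) F @[d --> \oo] --> 1 - energy x m.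
  have lim : (1 - \sum_(l <- frequencies m) nsq (transform 0 d (x - l)) +
     \sum_(l <- frequencies m) nsq (fourier mu (x - l) - transform 0 d (x - l))) @[d --> \oo] -->
     1 - energy x m + \sum_(l <- frequencies m) 0.
    apply: cvgD.
      apply: cvgB; first exact: cvg_cst.
      apply: cvg_sum_seq => l; exact: nsq_transform_cvg HNM HB Hmu _.
    apply: cvg_sum_seq => l.
    have hr := Re_transform_cvg HNM HB Hmu (x := x - l).
    have hi := Im_transform_cvg HNM HB Hmu (x := x - l).
    have -> : (fun d => nsq (fourier mu (x - l) - transform 0 d (x - l))) =
        fun d => (complex.Re (fourier mu (x - l)) - complex.Re (transform 0 d (x - l))) *
                 (complex.Re (fourier mu (x - l)) - complex.Re (transform 0 d (x - l))) +
                 (complex.Im (fourier mu (x - l)) - complex.Im (transform 0 d (x - l))) *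
                 (complex.Im (fourier mu (x - l)) - complex.Im (transform 0 d (x - l))).
      by apply/funext => d; rewrite /nsq !raddfB !expr2.
    have hr0 : complex.Re (fourier mu (x - l)) - complex.Re (transform 0 d (x - l)) @[d --> \oo]
        --> (0 : R).
      by rewrite -[X in _ --> X](subrr (complex.Re (fourier mu (x - l)))); apply: cvgB;
        [exact: cvg_cst|exact: hr].
    have hi0 : complex.Im (fourier mu (x - l)) - complex.Im (transform 0 d (x - l)) @[d --> \oo]
        --> (0 : R).
      by rewrite -[X in _ --> X](subrr (complex.Im (fourier mu (x - l)))); apply: cvgB;
        [exact: cvg_cst|exact: hi].
    rewrite -[X in _ --> X](_ : 0 * 0 + 0 * 0 = 0); last by rewrite mul0r addr0.
    by apply: cvgD; apply: cvgM.
  rewrite big1// addr0 in lim.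
  apply: cvg_trans lim; apply: near_eq_cvg; exists m => // d /= md.
  have orth : {in frequencies m &, forall l l', inner (points 0 d) (fun t => expi (l * t))
      (fun t => expi (l' * t)) = (l == l')%:R}.
    apply: (orthonormal_expi n HNM Hodd) => l l' lm l'm ll'.
    have [k km zk] := frequencies_zero lm l'm ll'.
    by exists k => //; lia.
  rewrite /F (mean_nsqB (frequencies_uniq m) orth).
  have -> : mean (points 0 d) (fun t => nsq (expi (x * t))) = 1.
    rewrite (eq_mean (g := fun=> 1)) ?mean_cst ?(points_neq_nil _ HNM)// => t _.
    exact: nsq_expi.
  under [in RHS]eq_bigr do rewrite inner_expi.
  by under [X in _ + X = _]eq_bigr do rewrite -inner_expi.
have := cvg_lim (@Rhausdorff R) cv2; rewrite (cvg_lim (@Rhausdorff R) cv) => ->.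
by [].
Qed.

Lemma energy_le1 x m : energy x m <= 1.
Proof.
rewrite -subr_ge0 -expi_span_dist; apply: Rintegral_ge0 => t _; exact: nsq_ge0.
Qed.

Let split_sum m K (F : R -> R) : (m <= K)%N ->
  \sum_(l <- frequencies K) F l = \sum_(l <- frequencies m) F l +
  \sum_(l <- frequencies K | l \notin frequencies m) F l.
Proof.
move=> mK; rewrite (bigID (mem (frequencies m)))/=; congr (_ + _).
rewrite -big_filter; apply: perm_big; apply: uniq_perm.
- by rewrite filter_uniq// frequencies_uniq.
- exact: frequencies_uniq.
- move=> l; rewrite mem_filter; apply/andP/idP => [[]//|lm]; split => //.
  exact: frequencies_sub lm.
Qed.

Lemma energy_nondecreasing x : nondecreasing_seq (energy x).
Proof.
move=> m K mK; rewrite /energy (split_sum _ mK) lerDl.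
by apply: sumr_ge0 => l _; exact: nsq_ge0.
Qed.

(** The frequencies of level [m] divided by the scale stay in [-1/2, 1/2], where the
    transforms of the tails are bounded below: so the mass that the finite
    Parseval identities put on them does not escape in the limit. *)
Lemma fourier_lower x : exists K0, forall m l, (K0 <= m)%N -> l \in frequencies m ->
  nsq (transform 0 m (x - l)) <= 400 * nsq (fourier mu (x - l)).
Proof.
have [K1 HK1] := small_tails (ltac:(by []) : 0 < 1 / 50 :> R) Hsum.
have [K2 HK2] := scale_large HNM (20 * `|x|).
exists (maxn K1 K2) => m l; rewrite geq_max => /andP[K1m K2m] lm.
suff : nsq (transform 0 m (x - l)) * (1 / 400) <= nsq (fourier mu (x - l)) by lra.
apply: (cvgr_to_ge (nsq_transform_cvg HNM HB Hmu (x := x - l))); exists m => // d /= md.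
have -> : transform 0 d (x - l) = transform 0 m (x - l) * transform m (d - m) (x - l).
  by rewrite -(transform_add n HNM) subnKC.
rewrite nsqM ler_wpM2l ?nsq_ge0//.
apply: (nsq_transform_lower n HNM); first exact: HK1.
apply: (le_trans (ler_normB _ _)).
by have := frequencies_bound lm; have := HK2 m K2m; lra.
Qed.

(** By Parseval at level [m], the frequencies of level [K] carry all the mass except the
    part on the later frequencies; that part is dominated by the increments of
    [energy], which are small because [energy] is nondecreasing and bounded. *)
Lemma energy_large x (eps : R) : 0 < eps -> exists m, 1 - energy x m < eps.
Proof.
move=> eps0; have [K0 HK0] := fourier_lower x.
have e0 : 0 < eps / 800 by lra.
have [K1 HK1] := nondecreasing_tail (@energy_nondecreasing x) (energy_le1 x) e0.
pose K := maxn K0 K1; exists K.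
suff : 1 - eps / 2 <= energy x K by lra.
have cv : \sum_(l <- frequencies K) nsq (transform 0 d (x - l)) @[d --> \oo] --> energy x K.
  by apply: cvg_sum_seq => l; exact: nsq_transform_cvg HNM HB Hmu _.
apply: (cvgr_to_ge cv); exists K => // m /= Km.
have h1 := frequencies_ParsevalN m x; rewrite (split_sum _ Km) in h1.
rewrite lerBlDr -[X in X <= _]h1 lerD2l.
apply: (@le_trans _ _ (400 * (energy x m - energy x K))).
  rewrite [energy x m](split_sum _ Km) addrAC subrr add0r mulr_sumr.
  rewrite big_seq_cond [leRHS]big_seq_cond; apply: ler_sum => l /andP[lm _].
  by apply: HK0 => //; rewrite (leq_trans _ Km)// leq_maxl.
by have := HK1 K (leq_maxr _ _) m; lra.
Qed.

Definition spectrum : set R := [set x | exists m, x \in frequencies m].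

Lemma expi_in_span x : in_span mu spectrum (fun t => expi (x * t)).
Proof.
split; first by apply: cbcont_cmeas; exact: cbcont_expi.
move=> eps eps0; have [m mE] := energy_large x eps0.
exists [seq (fourier mu (x - l), l) | l <- frequencies m]; split.
  by move=> _ /mapP[l lm ->]; exists m.
rewrite /sqdist /trig_sum.
have -> : (\int[mu]_t (nsq (expi (x * t) - \sum_(p <- [seq (fourier mu (x - l), l) |
    l <- frequencies m]) p.1 * expi (p.2 * t)))%:E)%E =
  (\int[mu]_t (nsq (expi (x * t) - \sum_(l <- frequencies m)
    fourier mu (x - l) * expi (l * t)))%:E)%E.
  by apply: eq_integral => t _; rewrite big_map.
rewrite bcont_integralE ?expi_span_dist ?lte_fin//.
apply: cbcont_nsq; apply: cbcontD; first exact: cbcont_expi.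
by apply: cbcontN; exact: (cbcont_lincomb _ _ (fun l => l)).
Qed.

Lemma fourier_zero_at k x : zero_at k x -> (0 < k)%N -> fourier mu x = 0.
Proof.
move=> zk k0; apply/eqP; rewrite -nsq_eq0; apply/eqP.
have cv := nsq_transform_cvg HNM HB Hmu (x := x).
have : nsq (transform 0 d x) @[d --> \oo] --> (0 : R).
  apply: cvg_near_cst; exists k => // d /= kd.
  by rewrite (transform_eq0P n HNM Hodd 0 d x).2 ?nsq0//; exists k => //; lia.
move=> /(cvg_lim (@Rhausdorff R)); rewrite (cvg_lim (@Rhausdorff R) cv).
by [].
Qed.

Lemma fourier0 : fourier mu 0 = 1.
Proof.
have -> : fourier mu 0 = Complex (\int[mu]_t 1) (\int[mu]_t 0).
  by congr Complex; apply: eq_Rintegral => t _; rewrite mul0r expi0 conjc1 mulr1.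
have mu1 : mu [set: R] = 1%E by exact: probability_setT.
by rewrite !Rintegral_cst// [X in fine X]mu1 mul0r mulr1.
Qed.

Theorem dvd_spectral : spectral_measure mu.
Proof.
exists spectrum; split.
  rewrite (_ : spectrum = \bigcup_m [set` frequencies m]).
    apply: bigcup_countable => // m _; apply: finite_set_countable.
    exact: finite_seq.
  by apply/seteqP; split => x /= [m]; [move=> xm; exists m|move=> _ xm; exists m].
split.
- move=> l _; rewrite (_ : character l = fun x => expi (l * x)).
    by apply: in_L2_cbcont; exact: cbcont_expi.
  by apply/funext => x; exact: characterE.
- move=> l l' [m lm] [m' l'm']; rewrite L2inner_expi.
  have [->|ll'] := eqVneq l l'; first by rewrite subrr fourier0.
  have [k km zk] := frequencies_zero (frequencies_sub (leq_maxl m m') lm)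
    (frequencies_sub (leq_maxr m m') l'm') ll'.
  by apply: fourier_zero_at zk _; lia.
- move=> f fL eps eps0.
  have [_ fcl] := in_span_L2 expi_in_span fL.
  have [ps [psL fps]] := fcl (eps ^+ 2) (exprn_gt0 2 eps0).
  exists [fset p.2 | p in ps]%fset, (fun l => \sum_(p <- ps | p.2 == l) p.1); split.
    by move=> l /= /imfsetP[p /= pps ->]; exact: psL.
  apply/L2norm_ltP => //; apply: le_lt_trans fps.
  rewrite le_eqVlt; apply/orP; left; apply/eqP; apply: eq_integral => x _.
  congr ((nsq (_ - _))%:E); rewrite /trig_sum.
  under eq_bigr => l _ do rewrite characterE mulr_suml big_mkcond.
  rewrite exchange_big; apply: eq_big_seq => p pps.
  rewrite (bigD1_seq p.2)/=; [|by apply/imfsetP; exists p|exact: fset_uniq].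
  rewrite eqxx big1 ?addr0// => l /negbTE; rewrite eq_sym => ->.
  by [].
Qed.

End sufficiency.

Theorem theorem2p6 (R : realType) (N M n : nat -> nat) (B : nat -> {fset int})
    (mu : probability R R)
    (HB : forall k, (1 <= k)%N -> B k = digits (M k) (n k))
    (HNM : forall k, (1 <= k)%N -> (3 <= M k <= N k)%N)
    (Hodd : forall k, (1 <= k)%N -> odd (M k))
    (Hsum : (\sum_(1 <= k <oo) (((M k)%:R : R)^-1)%:E < +oo)%E)
    (Hmu : infinite_convolution N B mu) :
  spectral_measure mu <-> (forall k, (2 <= k)%N -> (M k %| N k)%N).
Proof.
split; last by move=> Hdvd; exact: dvd_spectral HNM Hodd HB Hmu Hsum Hdvd.
exact: spectral_dvd HNM Hodd HB Hmu Hsum.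
Qed.
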